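(* Let $n\in\mathbb{N}$. The linear span $\tilde{\mathcal{E}}_n$ of the elements $\Pi^{n,k}$, $k\in\mathbb{N}_0$, is a commutative sub-algebra of $\mathcal{P}_n$ of dimension $(n+1)/2$ if $n$ is odd, and $n/2$ if $n$ is even. As an algebra, $\tilde{\mathcal{E}}_n$ is generated by the single element $$\Pi^{n,0}=\Pi^\emptyset=\sum_{k=0}^{n-1}\Delta^{1^{.k}.(n-k)}.$$ Furthermore, $\big\{\frac1{2^k}\tilde\varrho_{n,k}\mid 1\le k\le n,\ k\equiv n\text{ modulo }2\big\}$ is a linear basis of $\tilde{\mathcal{E}}_n$ consisting of mutually orthogonal idempotents. In particular, $c|_{\tilde{\mathcal{E}}_n}$ is a monomorphism of algebras, mapping $\tilde{\mathcal{E}}_n$ onto the linear span of the elements $$\mathsf{char}_{n,k}:=\sum_{p}\mathsf{char}_p\qquad(k\equiv n\text{ modulo }2),$$ where the sum runs over all partitions $p$ of $n$ with all parts odd and with exactly $k$ parts.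
   Context: $K$ is a field of characteristic $0$. Permutations act on the right ($i\pi$ is the image of $i$) and products in $S_n$ are read from left to right; algebras are not required to have an identity. For $\pi\in S_n$: $\mathrm{Des}(\pi)=\{1\le i\le n-1\mid i\pi>(i+1)\pi\}$, $\mathrm{Peak}(\pi)=\{2\le i\le n-1\mid (i-1)\pi<i\pi>(i+1)\pi\}$. For $D\subseteq\{1,\ldots,n-1\}$ let $\Delta^D=\sum_{\mathrm{Des}(\pi)=D}\pi$ and $\Xi^D=\sum_{E\subseteq D}\Delta^E$; $\mathcal{D}_n$ is the span of the $\Delta^D$ (a subalgebra of $KS_n$), $\mathcal{D}=\bigoplus_{n\ge0}\mathcal{D}_n$. A composition of $n$ is a word $q=q_1.\cdots.q_k$ of positive integers with sum $n$; $\ell(q)=k$; $D(q)=\{q_1,q_1+q_2,\ldots,q_1+\cdots+q_{k-1}\}$, $\Delta^q=\Delta^{D(q)}$, $\Xi^q=\Xi^{D(q)}$; $1^{.k}$ is the word consisting of $k$ letters $1$. The outer product on $\mathcal{D}$ is $\Xi^r\star\Xi^q=\Xi^{r.q}$ (concatenation). For $P\subseteq\{2,\ldots,n-1\}$, $\Pi^P=\sum_{\mathrm{Peak}(\pi)=P}\pi$; $\mathcal{P}_n$ is the span of the $\Pi^P$ (a left ideal of $\mathcal{D}_n$). $\Pi^{n,k}$ is the sum of all permutations in $S_n$ having exactly $k$ peaks. $\tilde\Xi^n=2\Pi^\emptyset$. For $m\in\mathbb{N}$, $\varrho_m=\sum_q\frac{(-1)^{\ell(q)-1}}{\ell(q)}\Xi^q$,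 summed over all compositions $q$ of $m$; $\varrho_q=\varrho_{q_1}\star\cdots\star\varrho_{q_k}$ for $q=q_1.\cdots.q_k$; $\varrho_{n,k}=\frac1{k!}\sum\varrho_q$, summed over all compositions $q$ of $n$ of length $k$; and $\tilde\varrho_{n,k}=\varrho_{n,k}\tilde\Xi^n$ (product in $KS_n$). $\mathrm{Cl}_K(S_n)$ is the ring of $K$-valued class functions on $S_n$ with pointwise product; for $q$ with sum $n$, $\mathsf{char}_q$ is the characteristic function of the class of permutations whose cycle type is a rearrangement of $q$; $q?=\prod_ia_i!\,i^{a_i}$ ($a_i$ the multiplicity of $i$ in $q$), $\mathsf{ch}_q=q?\,\mathsf{char}_q$; the outer product $\bullet$ on $\bigoplus_n\mathrm{Cl}_K(S_n)$ is $\mathsf{ch}_r\bullet\mathsf{ch}_q=\mathsf{ch}_{r.q}$. $c:(\mathcal{D},\star)\to(\bigoplus_n\mathrm{Cl}_K(S_n),\bullet)$ is the unique algebra homomorphism sending $\Xi^n$ to the trivial character of $S_n$ for all $n$; it restricts to algebra epimorphisms $\mathcal{D}_n\to\mathrm{Cl}_K(S_n)$ for the ordinary products (Solomon). *)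

(* Defs.v *)
From HB Require Import structures.
From mathcomp Require Import all_boot all_fingroup all_algebra falgebra.

Set Warnings "-redundant-canonical-projection".

Set Implicit Arguments.
Unset Strict Implicit.
Unset Printing Implicit Defensive.

Import GRing.Theory.
Local Open Scope ring_scope.

(* A named copy of {ffun gT -> K}, so that its product is the convolution of  *)
(* the group algebra and not the pointwise product.                           *)
Definition galg (K : fieldType) (gT : finGroupType) := {ffun gT -> K^o}.

Section GroupAlgebra.
Context (K : fieldType) (gT : finGroupType).
Local Notation A := (galg K gT).

HB.instance Definition _ := Vector.copy A {ffun gT -> K^o}.

Definition gelt (s : gT) : A := [ffun t => (t == s)%:R : K^o].
Definition galg_mul (x y : A) : A :=
  \sum_(s : gT) \sum_(t : gT) (x s * y t) *: gelt (s * t)%g.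

Lemma galg_mulE (x y : A) u : galg_mul x y u = \sum_(s : gT) x s * y (s^-1 * u)%g.
Proof.
rewrite /galg_mul sum_ffunE; apply: eq_bigr => s _.
rewrite sum_ffunE (bigD1 (s^-1 * u)%g) //= big1 ?addr0.
  by rewrite !ffunE mulKVg eqxx [LHS]mulr1.
move=> t nt; rewrite !ffunE; case: eqP => [ut|_]; last by rewrite [LHS]mulr0.
by rewrite ut mulKg eqxx in nt.
Qed.

Lemma galg_mulA : associative galg_mul.
Proof.
move=> x y z; apply/ffunP=> u; rewrite !galg_mulE.
under eq_bigr => s _ do rewrite galg_mulE big_distrr /=.
under [RHS]eq_bigr => s _ do rewrite galg_mulE big_distrl /=.
rewrite [RHS]exchange_big; apply: eq_bigr => s _.
rewrite (reindex_inj (mulgI s^-1%g)) /=; apply: eq_bigr => t _.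
by rewrite invMg invgK -mulgA mulKVg mulrA.
Qed.

Lemma galg_mul1r : left_id (gelt 1%g) galg_mul.
Proof.
move=> x; apply/ffunP=> u; rewrite galg_mulE (bigD1 1%g) //= big1 ?addr0.
  by rewrite ffunE eqxx mul1r invg1 mul1g.
by move=> s /negbTE s1; rewrite ffunE s1 mul0r.
Qed.

Lemma galg_mulr1 : right_id (gelt 1%g) galg_mul.
Proof.
move=> x; apply/ffunP=> u; rewrite galg_mulE (bigD1 u) //= big1 ?addr0.
  by rewrite ffunE mulVg eqxx mulr1.
by move=> s su; rewrite ffunE -eq_mulVg1 (negbTE su) mulr0.
Qed.

Lemma galg_mulDl : left_distributive galg_mul +%R.
Proof.
move=> x y z; apply/ffunP=> u; rewrite ffunE !galg_mulE -big_split /=.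
by apply: eq_bigr => s _; rewrite ffunE mulrDl.
Qed.

Lemma galg_mulDr : right_distributive galg_mul +%R.
Proof.
move=> x y z; apply/ffunP=> u; rewrite ffunE !galg_mulE -big_split /=.
by apply: eq_bigr => s _; rewrite ffunE mulrDr.
Qed.

Lemma galg_1neq0 : gelt 1%g != 0 :> A.
Proof. by apply/eqP=> /ffunP/(_ 1%g)/eqP; rewrite !ffunE eqxx oner_eq0. Qed.

HB.instance Definition _ := GRing.Zmodule_isNzRing.Build A
  galg_mulA galg_mul1r galg_mulr1 galg_mulDl galg_mulDr galg_1neq0.

Lemma galg_scaleAl (a : K) (x y : A) : a *: (x * y) = (a *: x) * y.
Proof.
apply/ffunP=> u; rewrite ffunE [in LHS]galg_mulE [in RHS]galg_mulE.
rewrite [LHS]big_distrr; apply: eq_bigr => s _.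
by rewrite ffunE [LHS]mulrA.
Qed.

HB.instance Definition _ := GRing.Lmodule_isLalgebra.Build K A galg_scaleAl.

Lemma galg_scaleAr (a : K) (x y : A) : a *: (x * y) = x * (a *: y).
Proof.
apply/ffunP=> u; rewrite ffunE [in LHS]galg_mulE [in RHS]galg_mulE.
rewrite [LHS]big_distrr; apply: eq_bigr => s _.
by rewrite ffunE [LHS]mulrCA.
Qed.

HB.instance Definition _ := GRing.Lalgebra_isAlgebra.Build K A galg_scaleAr.
HB.instance Definition _ := Algebra_isFalgebra.Build K A.

End GroupAlgebra.

Notation KS K n := (galg K {perm 'I_n}).
Notation CF K n := {ffun {perm 'I_n} -> K^o}.

Definition is_comp (n : nat) (q : seq nat) := (sumn q == n) && (0 \notin q)%N.

Definition composition (n : nat) :=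
  {b : n.-bseq 'I_n.+1 | is_comp n [seq val i | i <- b]}.
Coercion comp_word n (q : composition n) : seq nat := [seq val i | i <- val q].

Definition partition_of (n : nat) := {q : composition n | sorted geq q}.
Coercion part_comp n (p : partition_of n) : composition n := val p.

Lemma sumn_comp n (q : composition n) : sumn q = n.
Proof. by case/andP: (valP q) => /eqP. Qed.

Lemma comp_word_inj n : injective (@comp_word n).
Proof. by move=> q r /(inj_map val_inj) /val_inj /val_inj. Qed.

Lemma comp_wordP n (w : seq nat) :
  is_comp n w -> exists q : composition n, w = comp_word q.
Proof.
move=> cw; have /andP[/eqP sw w0] := cw.
have bnd : all (fun i => i < n.+1)%N w.
  rewrite -sw; elim: (w) => //= a v IHv; rewrite ltnS leq_addr /=.
  by apply: sub_all IHv => i; rewrite !ltnS => /leq_trans-> //; apply: leq_addl.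
have sz : (size w <= n)%N.
  rewrite -sw; elim: (w) w0 => //= a v IHv.
  rewrite inE negb_or => /andP[a0 /IHv sv].
  by apply: leq_ltn_trans sv _; rewrite -[ltnLHS]add0n ltn_add2r lt0n eq_sym.
pose v := [seq inord i : 'I_n.+1 | i <- w].
have vw : [seq val i | i <- v] = w.
  rewrite -map_comp -[RHS]map_id; apply/eq_in_map => i /(allP bnd) /= lt_i.
  by rewrite inordK.
have szv : (size v <= n)%N by rewrite size_map.
have cb : is_comp n [seq val i | i <- Bseq szv] by rewrite /= vw.
by exists (exist _ (Bseq szv) cb); rewrite /comp_word /= vw.
Qed.

Section Descents.
Variable n : nat.
Implicit Type s : {perm 'I_n}.

(* Letters are shifted: the ordinal j stands for the letter j+1, and          *)
(* [letter s i] is the image of the letter i in 1..n. Positions of descents   *)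
(* and peaks are not shifted: the ordinal i in a set of type {set 'I_n}       *)
(* stands for the position i (sets of descents or of peaks never contain 0).  *)
Definition letter s (i : nat) : nat :=
  nth 0%N [seq (val (s j)).+1 | j : 'I_n] i.-1.

Definition Des s : {set 'I_n} :=
  [set i : 'I_n | (1 <= i)%N && (letter s i.+1 < letter s i)%N].

Definition Peak s : {set 'I_n} :=
  [set i : 'I_n | [&& (2 <= i)%N, (letter s i.-1 < letter s i)%N
                    & (letter s i.+1 < letter s i)%N]].

Definition comp_set (q : seq nat) : {set 'I_n} :=
  [set i : 'I_n | [exists j : 'I_(size q), (0 < j)%N && (i == sumn (take j q) :> nat)]].

Definition cycle_type s : seq nat := [seq #|X| | X : {set 'I_n} in porbits s].

End Descents.

(* The coefficient of b i in v, for a basis b of a space containing v.        *)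
Definition fcoord (K : fieldType) (V : vectType K) (I : finType) (b : I -> V)
    (i : I) (v : V) : K :=
  coord [tuple b (enum_val j) | j < #|I|] (enum_rank i) v.

Section DescentAlgebra.
Variable K : fieldType.

Definition Delta n (D : {set 'I_n}) : KS K n :=
  \sum_(s : {perm 'I_n} | Des s == D) gelt K s.

Definition Xi_set n (D : {set 'I_n}) : KS K n :=
  \sum_(E : {set 'I_n} | E \subset D) Delta E.

Definition Xi n (q : seq nat) : KS K n := Xi_set (comp_set n q).

(* Delta D = 0 if D contains the spurious position 0.                         *)
Definition Dspace n : {vspace KS K n} := <<[seq Delta D | D : {set 'I_n}]>>%VS.

(* The outer product on the descent algebras, extended bilinearly; it is      *)
(* only meaningful on Dspace m and Dspace n.                                  *)
Definition star m n (x : KS K m) (y : KS K n) : KS K (m + n) :=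
  \sum_(r : composition m) \sum_(q : composition n)
    (fcoord (fun r : composition m => Xi m r) r x *
     fcoord (fun q : composition n => Xi n q) q y) *: Xi (m + n) (r ++ q).

Definition Pi_set n (P : {set 'I_n}) : KS K n :=
  \sum_(s : {perm 'I_n} | Peak s == P) gelt K s.

Definition Pspace n : {vspace KS K n} := <<[seq Pi_set P | P : {set 'I_n}]>>%VS.

Definition Pi_num n (k : nat) : KS K n :=
  \sum_(s : {perm 'I_n} | #|Peak s| == k) gelt K s.

(* Pi_num n k = 0 for k > n.                                                  *)
Definition Etilde n : {vspace KS K n} := <<[seq Pi_num n k | k <- iota 0 n.+1]>>%VS.

Definition Xi_tilde n : KS K n := 2%:R *: Pi_set set0.

Definition rho m : KS K m :=
  \sum_(q : composition m) ((-1) ^+ (size q).-1 / (size q)%:R) *: Xi m q.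

Fixpoint rho_word (q : seq nat) : KS K (sumn q) :=
  match q return KS K (sumn q) with
  | [::] => Xi 0 [::]
  | m :: q' => star (rho m) (rho_word q')
  end.

Definition rho_num n k : KS K n :=
  (k`!%:R)^-1 *:
    \sum_(q : composition n | size q == k)
      ecast i (KS K i) (sumn_comp q) (rho_word q).

Definition rho_tilde n k : KS K n := rho_num n k * Xi_tilde n.

Definition class_fun n (f : CF K n) := forall s t : {perm 'I_n}, f (s ^ t)%g = f s.

Definition char_word n (q : seq nat) : CF K n :=
  [ffun s : {perm 'I_n} => (perm_eq (cycle_type s) q)%:R : K^o].

Definition qfact (q : seq nat) : nat :=
  (\prod_(i <- undup q) ((count_mem i q)`! * i ^ count_mem i q))%N.

Definition ch n (q : seq nat) : CF K n := (qfact q)%:R *: char_word n q.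

(* The outer product of class functions, extended bilinearly; it is only      *)
(* meaningful on class functions.                                             *)
Definition outer m n (f : CF K m) (g : CF K n) : CF K (m + n) :=
  \sum_(p : partition_of m) \sum_(q : partition_of n)
    (fcoord (fun p : partition_of m => ch m p) p f *
     fcoord (fun q : partition_of n => ch n q) q g) *: ch (m + n) (p ++ q).

(* The homomorphism c from the direct sum of the Dspace n to the direct sum   *)
(* of the spaces of class functions, as the family of its homogeneous         *)
(* components; c n stands for its restriction to Dspace n, and its values     *)
(* outside of Dspace n are irrelevant. For n = 0, the word [:: 0] has the     *)
(* same comp_set (namely set0) as the empty composition.                      *)
Definition solomon_hom (c : forall n, 'Hom(KS K n, CF K n)) :=
  [/\ forall n, {in Dspace n, forall x, class_fun (c n x)},
      forall m n, {in Dspace m & Dspace n, forall x y,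
        c (m + n)%N (star x y) = outer (c m x) (c n y)}
    & forall n, c n (Xi n [:: n]) = [ffun=> 1]].

Definition char_num n k : CF K n :=
  \sum_(p : partition_of n | all odd p && (size p == k)) char_word n p.

(* Subalgebras need not contain an identity.                                  *)
Definition generated_by (A : falgType K) (E : {vspace A}) (x : A) :=
  [/\ (E * E <= E)%VS, x \in E
    & forall F : {vspace A}, (F * F <= F)%VS -> x \in F -> (E <= F)%VS].

End DescentAlgebra.

(* Main.v *)
Require Import Defs.
From HB Require Import structures.
From mathcomp Require Import all_boot all_fingroup all_algebra falgebra.
From mathcomp Require Import zify ring.

Set Implicit Arguments.
Unset Strict Implicit.
Unset Printing Implicit Defensive.

Import GRing.Theory.
Local Open Scope ring_scope.

(* Let Theta_A be the sum over the permutations s of s times the number of     *)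
(* maps f from the positions to a totally ordered alphabet A of positive and   *)
(* negative letters such that i < j implies f i < f j, or f i = f j is         *)
(* positive and s i < s j, or f i = f j is negative and s j < s i.             *)
(* Standardization gives Theta_A Theta_B = Theta_C, where C is A x B ordered   *)
(* lexicographically, B being reversed below negative letters, with the        *)
(* product signs. Let Q_x be the alphabet -1 < 1 < -2 < 2 < ... < -x < x. The  *)
(* letters 1, ..., x give \sum_k x^k rho_{n,k}, and Q_1 gives Xi_tilde; hence  *)
(* Theta_{Q_x} = \sum_k x^k rho_tilde_{n,k} = \sum_k (2x)^k e_k, where the e_k *)
(* are the elements of the theorem, and Theta_{Q_x} Theta_{Q_y} =              *)
(* Theta_{Q_{2xy}}. Comparing coefficients of x^k y^l shows that the e_k are   *)
(* orthogonal idempotents. The coefficient of s in Theta_{Q_x} only depends on *)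
(* the number of peaks of s, so that the e_k belong to Etilde, whose dimension *)
(* is at most the number of possible peak numbers; this is also the number of  *)
(* the e_k with k = n modulo 2, and these do not vanish.                       *)
(*   A linear map L with L (Xi q) = \prod_i h_{q_i}, where the h_i have the    *)
(* generating series exp (\sum_i y_i t^i / i), sends e_k to the sum of         *)
(* \prod_i y_{p_i} / p? over the partitions p of n with k parts, all odd. For  *)
(* the coefficient of the identity (y_i = 1) this shows that e_k is nonzero;   *)
(* for c followed by the Frobenius characteristic, c e_k = char_{n,k}.         *)

(** * Standardization and products of theta elements *)

(** Everything is read off from the family T(x) = Theta_{Q_x}. It equals sum_k x^k [rho_tilde n k]
    by [Theta_pos_rho], where (1 + z)^x = exp (x log (1 + z)) turns binomial coefficients into the
    elements [rho_num], together with [Theta_pos_mul] and [Xi_tilde_Theta]. The rule T(x) T(y) = T(2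
    x y) is [Theta_alt_mul], an instance of [Theta_mul]; in characteristic 0 coefficients may be
    compared by interpolation, which yields [rho_tilde_mul].

    By [ThetaE] the coefficients of T(x) count factorizations of words into V-shaped factors, and by
    [vpow_peak_poly] this count depends only on the length and the number of peaks. At most
    [uphalf n] peak numbers occur, so the dimension is at most [uphalf n]; as many orthogonal
    idempotents are nonzero by [eidem_neq0], and [eidem_basis] follows. The algebra is thus a
    product of copies of K. On the k-th copy [Pi_num K n 0] acts by 2^(k-1), and these scalars are
    distinct and nonzero, whence [Etilde_generated].

    [L_eidem] computes the image of an idempotent under any linear map that is multiplicative on the
    elements Xi. It is used for the coefficient of the identity in [eidem_neq0] and for [c] in
    [c_eidem]. The images under [c] are indicator functions of disjoint nonempty sets of
    permutations, so [c] is multiplicative and injective ([c_mul], [c_inj]). *)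

Lemma card_ord_lt n m : (m <= n)%N -> #|[set i : 'I_n | (i < m)%N]| = m.
Proof.
move=> le_mn; rewrite cardsE -sum1_card -[RHS]card_ord -sum1_card.
by rewrite (big_ord_widen n (fun=> 1%N) le_mn).
Qed.

Lemma card_perm_lt n (s : {perm 'I_n}) m :
  (m <= n)%N -> #|[set i | (s i < m)%N]| = m.
Proof.
move=> le_mn; rewrite -[RHS](card_ord_lt le_mn) -(card_imset _ (@perm_inj _ s)).
apply: eq_card => i; rewrite inE; apply/imsetP/idP => [[j]|lt_im].
  by rewrite inE => lt_jm ->.
by exists (s^-1 i)%g; rewrite ?inE permKV.
Qed.

(** The value [s i] is the number of positions [j] with [s j < s i], so the order pattern determines
    [s]. *)
Lemma perm_lt_inj n (s t : {perm 'I_n}) :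
  (forall i j, (s i < s j) = (t i < t j))%N -> s = t.
Proof.
move=> st; apply/permP=> i; apply/val_inj.
rewrite /= -(card_perm_lt s (ltnW (ltn_ord (s i)))).
rewrite -[RHS](card_perm_lt t (ltnW (ltn_ord (t i)))).
by apply: eq_card => j; rewrite !inE st.
Qed.

(** Take for [s i] the number of elements below [i]: this rank is strictly monotone for [r], hence
    injective by totality. *)
Lemma standardization n (r : rel 'I_n) :
    irreflexive r -> transitive r ->
    (forall i j, i != j -> r i j || r j i) ->
  exists s : {perm 'I_n}, forall i j, (s i < s j)%N = r i j.
Proof.
move=> irr tr tot; pose below i := [set j | r j i].
have rk_lt i : (#|below i| < n)%N.
  rewrite -[ltnRHS]card_ord -cardsT; apply/proper_card/properP.
  by split; [apply: subsetT | exists i; rewrite ?inE ?irr].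
have mono i j : r i j -> (#|below i| < #|below j|)%N.
  move=> rij; apply/proper_card/properP; split.
    by apply/subsetP=> k; rewrite !inE => /tr; apply.
  by exists i; rewrite inE ?irr.
have inj : injective (fun i => Ordinal (rk_lt i)).
  move=> i j /(congr1 val) /= eq_rk; apply/eqP/negPn/negP => /tot.
  by case/orP=> /mono; rewrite eq_rk ltnn.
exists (perm inj) => i j; rewrite !permE /=.
apply/idP/idP => [lt_rk|/mono//]; case: (eqVneq i j) lt_rk => [->|ne].
  by rewrite ltnn.
case/orP: (tot _ _ ne) => // /mono lt_ji lt_ij.
by have := ltn_trans lt_ij lt_ji; rewrite ltnn.
Qed.

(* A sign predicate makes the letters of a totally ordered alphabet positive   *)
(* or negative; positive letters are repeated along ascents, negative ones     *)
(* along descents.                                                             *)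
Definition keylt (sg : pred nat) (u v : nat * nat) :=
  ((u.1 < v.1) || (u.1 == v.1) && (if sg u.1 then u.2 < v.2 else v.2 < u.2))%N.

Lemma keylt_irr sg : irreflexive (keylt sg).
Proof. by move=> u; rewrite /keylt !ltnn eqxx; case: ifP. Qed.

Lemma keylt_trans sg : transitive (keylt sg).
Proof.
rewrite /keylt => -[b y] [a x] [c z] /=.
case/orP=> [ab|/andP[/eqP-> xy]]; last first.
  case/orP=> [->//|/andP[/eqP<- yz]]; rewrite eqxx ltnn /=.
  by move: xy yz; case: ifP => _; [apply: ltn_trans | move=> /[swap]; apply:
    ltn_trans].
by case/orP=> [/(ltn_trans ab)->//|/andP[/eqP<-]]; rewrite ab.
Qed.

Lemma keylt_total sg u v : u.2 != v.2 -> keylt sg u v || keylt sg v u.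
Proof.
rewrite /keylt; case: (ltngtP u.1 v.1) => //= ->.
by case: (sg _); case: ltngtP.
Qed.

Section Theta.
Variables (K : fieldType) (n : nat).

Definition key N (f : {ffun 'I_n -> 'I_N}) (s : {perm 'I_n}) (i : 'I_n) :=
  (val (f i), val (s i)).

Definition compat N sg (f : {ffun 'I_n -> 'I_N}) (s : {perm 'I_n}) :=
  [forall i : 'I_n, forall j : 'I_n,
     (i < j)%N ==> keylt sg (key f s i) (key f s j)].

(** Positions are totally ordered and [keylt] is a strict order, so the implication in [compat] is
    an equivalence. *)
Lemma compatP N sg (f : {ffun 'I_n -> 'I_N}) (s : {perm 'I_n}) :
  reflect (forall i j : 'I_n, (i < j)%N = keylt sg (key f s i) (key f s j))
    (compat sg f s).
Proof.
apply: (iffP forallP) => [H i j|H i]; last first.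
  by apply/forallP=> j; apply/implyP; rewrite H.
have {}H (i' j' : 'I_n) : (i' < j')%N -> keylt sg (key f s i') (key f s j').
  by move/forallP: (H i') => /(_ j') /implyP.
case: (ltngtP i j) => [/H->//|/H ji|/val_inj->]; last by rewrite keylt_irr.
by apply/esym/negP => /(keylt_trans ji); rewrite keylt_irr.
Qed.

(** Theta_A for the alphabet 0 < ... < N - 1, in which [k] is positive when [sg k] holds. With
    [N = x * 2] and [sg = odd] the alphabet is Q_x: the letter 2j plays the role of -(j+1) and 2j+1
    that of j+1. *)
Definition Theta N sg : KS K n :=
  [ffun s => (\sum_(f : {ffun 'I_n -> 'I_N}) compat sg f s)%N%:R : K^o].

(** The coefficient of [u] in the product counts triples of [s], [f] compatible with [s], and [g]
    compatible with [s^-1 * u]. After transporting [g] along [s], exactly one [s] fits a given [g],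
    namely the standardization of the keys of [g] and [u]; the remaining condition says that the
    pair of [f] and [g], a map to the product alphabet, is compatible with [u]. *)
Lemma Theta_mul N M P (sg sg' sg'' : pred nat) (tau : 'I_N * 'I_M -> 'I_P) :
    bijective tau ->
    (forall a b, sg'' (tau (a, b)) = (sg a == sg' b)) ->
    (forall a b c d, (tau (a, b) < tau (c, d))%N =
       ((a < c) || (a == c) && (if sg a then b < d else d < b))%N) ->
  Theta N sg * Theta M sg' = Theta P sg''.
Proof.
move=> bij_tau tau_sg tau_lt; apply/ffunP=> u.
rewrite [LHS]galg_mulE ffunE.
under eq_bigr => s _ do rewrite !ffunE -[_ * _]natrM.
rewrite -natr_sum; congr _%:R.
have tau_inj := bij_inj bij_tau.
pose relabel (g : {ffun 'I_n -> 'I_M}) (s : {perm 'I_n}) := [ffun i => g (s i)].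
pose glue (p : {ffun 'I_n -> 'I_N} * {ffun 'I_n -> 'I_M}) :=
  [ffun i => tau (p.1 i, p.2 i)].
have bij_glue : bijective glue.
  have [tau' tauK tau'K] := bij_tau.
  exists (fun h : {ffun _} => ([ffun i => (tau' (h i)).1], [ffun i => (tau' (h
    i)).2])).
    by case=> f g; congr (_, _); apply/ffunP=> i; rewrite !ffunE tauK.
  by move=> h; apply/ffunP=> i; rewrite !ffunE /= -surjective_pairing tau'K.
rewrite [RHS](reindex glue) /=; last exact: onW_bij.
rewrite -(pair_bigA _ (fun f g => compat sg'' (glue (f, g)) u : nat)) /=.
transitivity (\sum_(f : {ffun 'I_n -> 'I_N}) \sum_(g : {ffun 'I_n -> 'I_M})
   \sum_(s : {perm 'I_n}) compat sg f s * compat sg' (relabel g s^-1%g) (s^-1 *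
     u)%g)%N.
  rewrite [RHS](eq_bigr _ (fun f _ => exchange_big _ _ _ _ _ _)) /=.
  rewrite [RHS]exchange_big; apply: eq_bigr => s _ /=.
  rewrite big_distrl /=; apply: eq_bigr => f _.
  rewrite big_distrr /=.
  rewrite (reindex (relabel^~ s^-1%g)) //.
  apply: onW_bij; exists (relabel^~ s).
    by move=> g; apply/ffunP=> i; rewrite !ffunE permK.
  by move=> g; apply/ffunP=> i; rewrite !ffunE permKV.
apply: eq_bigr => f _; apply: eq_bigr => g _.
have [s0 s0P] : exists s0 : {perm 'I_n}, forall i j,
    (s0 i < s0 j)%N = keylt sg' (key g u i) (key g u j).
  apply: (@standardization _ (fun i j => keylt sg' (key g u i) (key g u j))).
  - by move=> i; apply: keylt_irr.
  - by move=> i j k; apply: keylt_trans.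
  - by move=> i j ne; apply: keylt_total => /=; rewrite (inj_eq val_inj)
    (inj_eq perm_inj).
have s0E s : compat sg' (relabel g s^-1%g) (s^-1 * u)%g = (s == s0).
  apply/compatP/eqP => [sP|->].
    apply: perm_lt_inj => i j; rewrite s0P sP.
    by congr (keylt _ _ _); rewrite /key ffunE permM permK.
  by move=> i j; rewrite -{1}(permKV s0 i) -{1}(permKV s0 j) s0P /key !ffunE
    !permM.
rewrite (bigD1 s0) //= big1 ?addn0; last first.
  by move=> s /negbTE ns; rewrite s0E ns muln0.
rewrite s0E eqxx muln1; congr nat_of_bool.
have tau_eq a b c d : (tau (a, b) == tau (c, d) :> nat) = (a == c) && (b == d).
  by rewrite -xpair_eqE -(inj_eq tau_inj).
(* When the first letters tie, the comparison by [s0] is that by the keys of [g] and [u], reversed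
   if the first letter is negative. The reversal also swaps the meaning of the sign of the second
   letter, which is why signs multiply. *)
have keyE (i j : 'I_n) : keylt sg (key f s0 i) (key f s0 j) =
    keylt sg'' (key (glue (f, g)) u i) (key (glue (f, g)) u j).
  rewrite /keylt /= !ffunE /= tau_lt tau_eq tau_sg !s0P /keylt /=.
  rewrite -!(inj_eq val_inj) /=.
  case: (ltngtP (f i) (f j)) => //= _.
  by case: (sg (f i)); case: (ltngtP (g i) (g j)) => /= [_|_|->]; case: (sg'
    _); case: (u i < u j)%N; case: (u j < u i)%N.
apply/idP/idP => /compatP H; apply/compatP => i j; by rewrite H keyE.
Qed.
End Theta.

Section Lexord.
Variables (N M : nat) (sg : pred nat).

Lemma lexord_subproof (p : 'I_N * 'I_M) :
  (p.1 * M + (if sg p.1 then p.2 : nat else M.-1 - p.2) < N * M)%N.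
Proof.
case: p => [[a ltaN] [b ltbM]] /=.
have : ((if sg a then b else M.-1 - b) < M)%N by case: ifP => _; lia.
by move: (if _ then _ else _) => c ltcM; nia.
Qed.

Definition lexord p : 'I_(N * M) := Ordinal (lexord_subproof p).

Lemma lexord_lt a b c d : (lexord (a, b) < lexord (c, d))%N =
  ((a < c) || (a == c) && (if sg a then b < d else d < b))%N.
Proof.
case: a b c d => [a lta] [b ltb] [c ltc] [d ltd] /=; rewrite -(inj_eq val_inj)
  /=.
have [lt_ac|lt_ca|->] := ltngtP a c => /=.
- have : ((if sg a then b else M.-1 - b) < M)%N by case: ifP => _; lia.
  by move: (if _ then _ else _) => e lte; nia.
- have : ((if sg c then d else M.-1 - d) < M)%N by case: ifP => _; lia.
  by move: (if _ then _ else _) => e lte; nia.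
by rewrite ltn_add2l; case: ifP => _; lia.
Qed.

Lemma lexord_bij : bijective lexord.
Proof.
apply: inj_card_bij; last by rewrite card_prod !card_ord.
case=> [a b] [c d] eq_ab.
have := lexord_lt a b c d; have := lexord_lt c d a b; rewrite eq_ab ltnn.
rewrite -!(inj_eq val_inj) /=; case: (ltngtP a c) => //= /val_inj->.
by case: (sg c); case: (ltngtP b d) => //= /val_inj->.
Qed.

End Lexord.

Lemma Theta_pos_mul (K : fieldType) n x :
  Theta K n x xpredT * Theta K n 2 odd = Theta K n (x * 2) odd.
Proof.
apply: (Theta_mul _ _ (lexord_bij x 2 xpredT)) => [a b|]; last exact: lexord_lt.
by rewrite /= oddD oddM andbF.
Qed.

(** Reversing an alphabet of even length flips the parity of every index. So the lexicographic index
    of a pair is odd exactly when the two signs agree, and the product of Q_x and Q_y is Q_{2xy}. *)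
Lemma Theta_alt_mul (K : fieldType) n x y :
  Theta K n (x * 2) odd * Theta K n (y * 2) odd = Theta K n (x * 2 * (y * 2))
    odd.
Proof.
apply: (Theta_mul _ _ (lexord_bij _ _ odd)) => [a b|]; last exact: lexord_lt.
rewrite /= oddD !oddM !andbF /=; case: (odd a) => //=.
by have := ltn_ord b; lia.
Qed.

(** * Convolution of functions on words *)

Definition word n (s : {perm 'I_n}) : seq nat := [seq val (s i) | i <- enum
  'I_n].

Lemma size_word n (s : {perm 'I_n}) : size (word s) = n.
Proof. by rewrite size_map size_enum_ord. Qed.

Lemma nth_word n (s : {perm 'I_n}) (i : 'I_n) : nth 0%N (word s) i = s i.
Proof. by rewrite (nth_map i) ?size_enum_ord // nth_ord_enum. Qed.

Lemma word_uniq n (s : {perm 'I_n}) : uniq (word s).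
Proof. by rewrite map_inj_uniq ?enum_uniq // => i j /val_inj/perm_inj. Qed.

Definition monotone (b : bool) (w : seq nat) := if b then sorted ltn w else
  sorted gtn w.

Section Splits.
Variable K : fieldType.
Implicit Types (V W F G : seq nat -> K) (w : seq nat).

(* The convolution dual to the deconcatenation of words.                       *)
Definition conv V W w := \sum_(i < (size w).+1) V (take i w) * W (drop i w).

Definition unitw w : K := (w == [::])%:R.

Lemma conv_nil V W : conv V W [::] = V [::] * W [::].
Proof. by rewrite /conv big_ord1. Qed.

Lemma conv_cons V W x w :
  conv V W (x :: w) = V [::] * W (x :: w) + conv (fun u => V (x :: u)) W w.
Proof. by rewrite /conv big_ord_recl. Qed.

Lemma eq_conv V V' W W' w : (forall u, size u <= size w -> V u = V' u)%N ->
  (forall u, size u <= size w -> W u = W' u)%N -> conv V W w = conv V' W' w.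
Proof.
move=> eqV eqW; apply: eq_bigr => i _; rewrite eqV ?eqW // ?size_drop ?leq_subr
  //.
by rewrite size_take_min geq_minr.
Qed.

Lemma eq_convr V W W' : W =1 W' -> conv V W =1 conv V W'.
Proof. by move=> eqW w; apply: eq_conv. Qed.

Lemma conv_lin V W a F w :
  conv (fun u => a * V u + W u) F w = a * conv V F w + conv W F w.
Proof.
rewrite /conv big_distrr -big_split; apply: eq_bigr => i _ /=.
by rewrite mulrDl mulrA.
Qed.

Lemma convA V W F w : conv V (conv W F) w = conv (conv V W) F w.
Proof.
elim: w V => [|x w IHw] V; first by rewrite !conv_nil mulrA.
rewrite !conv_cons IHw mulrDr mulrA conv_nil -addrA; congr (_ + _).
rewrite -conv_lin; apply: eq_conv => // u _; by rewrite conv_cons.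
Qed.

Lemma conv_sumr (I : Type) (r : seq I) (P : pred I) V (F : I -> seq nat -> K) w
  :
  conv V (fun u => \sum_(i <- r | P i) F i u) w = \sum_(i <- r | P i) conv V (F
    i) w.
Proof.
by rewrite exchange_big; apply: eq_bigr => i _; rewrite big_distrr.
Qed.

Lemma conv_suml (I : Type) (r : seq I) (P : pred I) V (F : I -> seq nat -> K) w
  :
  conv (fun u => \sum_(i <- r | P i) F i u) V w = \sum_(i <- r | P i) conv (F
    i) V w.
Proof.
by rewrite exchange_big; apply: eq_bigr => i _; rewrite big_distrl.
Qed.

Lemma conv_scaler V a F w : conv V (fun u => a * F u) w = a * conv V F w.
Proof. by rewrite /conv big_distrr; apply: eq_bigr => i _; rewrite /= mulrCA.
  Qed.

Lemma conv_scalel V a F w : conv (fun u => a * F u) V w = a * conv F V w.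
Proof. by rewrite /conv big_distrr; apply: eq_bigr => i _; rewrite /= mulrA.
  Qed.

Lemma conv1w V w : conv unitw V w = V w.
Proof.
rewrite /conv big_ord_recl take0 drop0 /unitw eqxx mul1r big1 ?addr0 // => i _.
by case: w i => [[]|x w i] //=; rewrite mul0r.
Qed.

Definition nonnil V w := (w != [::])%:R * V w.

Lemma conv_nonnil V F w : V [::] = 1 -> conv V F w = F w + conv (nonnil V) F w.
Proof.
move=> V1; case: w => [|x w]; first by rewrite !conv_nil /nonnil !mul0r addr0
  V1 mul1r.
rewrite !conv_cons V1 mul1r [nonnil V [::]]mul0r mul0r add0r; congr (_ + _).
by apply: eq_conv => // u _; rewrite /nonnil mul1r.
Qed.

Definition powconv V m := iter m (conv V) unitw.

(** Binomial theorem for [V = unitw + nonnil V]. The terms with m > x vanish, so any bound [N] above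
    [x] serves. *)
Lemma powconv_nonnil V x N w : V [::] = 1 -> (x < N)%N ->
  powconv V x w = \sum_(m < N) 'C(x, m)%:R * powconv (nonnil V) m w.
Proof.
move=> V1; elim: x w => [|x IHx] w ltxN.
  case: N ltxN => // N _; rewrite big_ord_recl bin0 mul1r big1 ?addr0 //.
  by move=> i _; rewrite bin0n mul0r.
rewrite [LHS](@conv_nonnil V (powconv V x)) // IHx; last exact: ltnW.
rewrite (eq_convr _ (fun u => IHx u (ltnW ltxN))) conv_sumr.
case: N ltxN IHx => // N ltxN IHx.
rewrite [RHS]big_ord_recl bin0 mul1r big_ord_recl bin0 mul1r -addrA; congr (_ +
  _).
rewrite [X in _ + X]big_ord_recr /= bin_small // conv_scaler mul0r addr0
  -big_split.
apply: eq_bigr => i _ /=; rewrite conv_scaler binS natrD mulrDl; congr (_ * _ +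
  _).
Qed.

(** * Factorizations into monotone factors *)

Definition mono b w : K := (monotone b w)%:R.

(** The number of ways to cut a word into consecutive, possibly empty factors, one for each sign in
    [A], increasing for [true] and decreasing for [false]. *)
Definition splits (A : seq bool) := foldr (fun b F => conv (mono b) F) unitw A.

Definition ltb (b : bool) (x y : nat) := if b then (x < y)%N else (y < x)%N.

Lemma mono_cons2 b x y w : mono b [:: x, y & w] = (ltb b x y)%:R * mono b (y ::
  w).
Proof. by rewrite /mono /ltb; case: b => /=; case: (_ < _)%N; rewrite ?mul1r
  ?mul0r. Qed.

Lemma mono1 b x : mono b [:: x] = 1. Proof. by rewrite /mono; case: b. Qed.
Lemma mono0 b : mono b [::] = 1. Proof. by rewrite /mono; case: b. Qed.

Lemma splits_nil A : splits A [::] = 1.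
Proof. by elim: A => //= b A IHA; rewrite conv_nil mono0 IHA mul1r. Qed.

(** Restricts the count to factorizations whose first factor, of sign [b], begins with [x]. *)
Definition splits_from b A x w := conv (fun u => mono b (x :: u)) (splits A) w.

Lemma splits_cons b A x w :
  splits (b :: A) (x :: w) = splits A (x :: w) + splits_from b A x w.
Proof. by rewrite /= conv_cons mono0 mul1r. Qed.

Lemma splits_from_cons b A x y w :
  splits_from b A x (y :: w) = splits A (y :: w) + (ltb b x y)%:R * splits_from
    b A y w.
Proof.
rewrite /splits_from conv_cons mono1 mul1r -conv_scalel; congr (_ + _).
by apply: eq_conv => // u _; rewrite mono_cons2.
Qed.

Variables (N : nat) (sg : pred nat).

(** Counts the assignments of letters to the entries of [w] for which the keys increase, starting
    from the key [u]. *)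
Fixpoint keypaths u w : K := if w is y :: w' then
  \sum_(j < N) (keylt sg u (val j, y))%:R * keypaths (val j, y) w' else 1.

Definition signs_from j := [seq sg k | k <- iota j (N - j)].

(** The index [i] is that of the factor containing the first entry; the factors before it are
    empty. *)
Lemma splits_sum j x w : (j <= N)%N -> splits (signs_from j) (x :: w) =
  \sum_(i < N | (j <= i)%N) splits_from (sg i) (signs_from i.+1) x w.
Proof.
move=> /subnKC; move: (N - j)%N => d; elim: d j => [|d IHd] j Nj.
  rewrite /signs_from -Nj addn0 subnn /= big1 // => -[i lti] /=.
  by move=> le_ji; exfalso; lia.
have ltjN : (j < N)%N by lia.
have -> : signs_from j = sg j :: signs_from j.+1 by rewrite /signs_from -subnSK.
rewrite splits_cons IHd ?addSnnS //.
rewrite [RHS](bigD1 (Ordinal ltjN)) //= addrC; congr (_ + _).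
by apply: eq_bigl => i; rewrite -(inj_eq val_inj) /= ltn_neqAle eq_sym andbC.
Qed.

(** The next entry either takes a later letter, which opens a new factor, or the same letter, and
    then must be larger or smaller according to its sign. *)
Lemma keypaths_splits j x w : (j < N)%N ->
  keypaths (j, x) w = splits_from (sg j) (signs_from j.+1) x w.
Proof.
elim: w j x => [|y w IHw] j x ltjN /=; first by rewrite /splits_from conv_nil
  mono1 splits_nil mul1r.
rewrite splits_from_cons splits_sum // (bigD1 (Ordinal ltjN)) //= addrC; congr
  (_ + _).
  rewrite [RHS]big_mkcond [LHS]big_mkcond; apply: eq_bigr => i _.
  rewrite IHw // /keylt /= -(inj_eq val_inj) /=.
  by case: ltngtP => /= _; rewrite ?mul0r ?mul1r.
by rewrite IHw // /keylt /= ltnn eqxx.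
Qed.

Lemma sum_keypaths x w :
  \sum_(j < N) keypaths (val j, x) w = splits (signs_from 0) (x :: w).
Proof.
rewrite splits_sum //; apply: eq_big => [j|j _]; rewrite ?leq0n //
  keypaths_splits ?ltn_ord //.
Qed.

End Splits.

Section ThetaSplits.
Variables (K : fieldType) (n : nat).

Lemma zip_map2 (T T1 T2 : Type) (f : T -> T1) (g : T -> T2) s :
  zip (map f s) (map g s) = [seq (f x, g x) | x <- s].
Proof. by elim: s => //= x s ->. Qed.

Lemma compat_sorted N sg (f : {ffun 'I_n -> 'I_N}) (s : {perm 'I_n}) :
  compat sg f s = sorted (keylt sg) (zip [seq val (f i) | i <- enum 'I_n] (word
    s)).
Proof.
rewrite zip_map2 (sorted_pairwise (@keylt_trans sg)); set e := [seq _ | _ <- _].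
have nthe (i : 'I_n) : nth (0, 0)%N e i = key f s i.
  by rewrite (nth_map i) ?size_enum_ord // nth_ord_enum.
have size_e : size e = n by rewrite size_map size_enum_ord.
apply/compatP/(pairwiseP (0, 0)%N) => [H i j|H i j].
  rewrite !inE size_e => lti ltj; move: (H (Ordinal lti) (Ordinal ltj)).
  by rewrite -!nthe /= => ->.
case: (ltngtP i j) => [lt_ij|lt_ji|/val_inj->]; last by rewrite keylt_irr.
  by rewrite -!nthe H // inE size_e.
apply/esym/negP; rewrite -!nthe => /keylt_trans/(_ (H j i _ _ lt_ji)).
by rewrite !inE size_e keylt_irr => /(_ (ltn_ord _) (ltn_ord _)).
Qed.

Lemma sum_ffun_recl N m (F : seq nat -> K) :
  \sum_(f : {ffun 'I_m.+1 -> 'I_N}) F [seq val (f i) | i <- enum 'I_m.+1] =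
  \sum_(j < N) \sum_(f : {ffun 'I_m -> 'I_N}) F (val j :: [seq val (f i) | i <-
    enum 'I_m]).
Proof.
pose ext (p : 'I_N * {ffun 'I_m -> 'I_N}) : {ffun 'I_m.+1 -> 'I_N} :=
  [ffun i => if unlift ord0 i is Some i' then p.2 i' else p.1].
have bij_ext : bijective ext.
  exists (fun f : {ffun 'I_m.+1 -> 'I_N} => (f ord0, [ffun i => f (lift ord0
    i)] : {ffun 'I_m -> 'I_N})).
    case=> j f; rewrite /ext ffunE unlift_none; congr (_, _).
    by apply/ffunP=> i; rewrite !ffunE liftK.
  move=> f; apply/ffunP=> i; rewrite ffunE /=.
  by case: unliftP => [i'|] ->; rewrite ?ffunE.
rewrite (reindex ext) /=; last exact: onW_bij.
rewrite pair_bigA; apply: eq_bigr => -[j f] _ /=.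
rewrite enum_ordSl /= ffunE unlift_none /= -map_comp; congr (F (_ :: _)).
by apply: eq_map => i /=; rewrite ffunE liftK.
Qed.

Lemma keypaths_sum N sg m u w : size w = m ->
  keypaths K N sg u w = \sum_(f : {ffun 'I_m -> 'I_N})
     (path (keylt sg) u (zip [seq val (f i) | i <- enum 'I_m] w))%:R.
Proof.
elim: w m u => [|y w IHw] [|m] u //=.
  move=> _; rewrite (eq_bigr (fun=> 1)) => [|f _].
    by rewrite sumr_const card_ffun !card_ord expn0.
  by rewrite enum_ord0.
case=> size_w; rewrite (sum_ffun_recl _ _ (fun l => (path (keylt sg) u (zip l
  (y :: w)))%:R)).
apply: eq_bigr => j _; rewrite (IHw m) // big_distrr; apply: eq_bigr => f _ /=.
by case: (keylt _ _ _); rewrite ?mul1r ?mul0r.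
Qed.

(** A map compatible with [s] is weakly increasing along the positions, so its fibres cut the word
    of [s] into consecutive factors; within a fibre the keys increase exactly when the factor is
    monotone in the direction given by the sign. *)
Lemma ThetaE N sg s : Theta K n N sg s = splits K [seq sg k | k <- iota 0 N]
  (word s).
Proof.
rewrite ffunE natr_sum.
under eq_bigr => f _ do rewrite compat_sorted.
move: (word s) (size_word s) => w; case: n => [|m] size_w.
  rewrite (size0nil size_w) splits_nil (eq_bigr (fun=> 1)) => [|f _].
    by rewrite sumr_const card_ffun !card_ord expn0.
  by rewrite enum_ord0.
case: w size_w => // x w [size_w].
rewrite (sum_ffun_recl _ _ (fun l => (sorted (keylt sg) (zip l (x :: w)))%:R)).
transitivity (\sum_(j < N) keypaths K N sg (val j, x) w).
  by apply: eq_bigr => j _; rewrite (keypaths_sum _ _ _ size_w).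
by rewrite sum_keypaths /signs_from subn0.
Qed.

Lemma Theta_posE x s :
  Theta K n x xpredT s = powconv (mono K true) x (word s).
Proof.
rewrite ThetaE; elim: x 0%N (word s) => [|x IHx] k w //=.
by apply: eq_convr => u; rewrite /= IHx.
Qed.

(** On words without repetition the value is 1 for the empty word, 2 for a nonempty word that
    decreases and then increases (the minimum may belong to either factor), and 0 otherwise. *)
Definition vshape := conv (mono K false) (mono K true).

Lemma Theta_altE x s : Theta K n (x * 2) odd s = powconv vshape x (word s).
Proof.
rewrite ThetaE; suff H k w : ~~ odd k ->
    splits K [seq odd j | j <- iota k (x * 2)] w = powconv vshape x w by apply:
      H.
elim: x k w => [|x IHx] k w even_k //.
rewrite mulSn /= (negbTE even_k) -convA.
apply: eq_convr => u /=; apply: eq_convr => v /=.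
by rewrite IHx //= negbK.
Qed.

End ThetaSplits.

(** * Peaks *)

Fixpoint npeaks (w : seq nat) : nat :=
  if w is a :: w1 then
    ((if w1 is [:: b, c & _] then (a < b) && (c < b) : nat else 0) + npeaks
      w1)%N
  else 0.

Lemma npeaks_cons2 a b w : (npeaks [:: a, b & w] =
  \sum_(i < size w) (nth 0 [:: a, b & w] i < nth 0 (b :: w) i)
                    && (nth 0 w i < nth 0 (b :: w) i))%N.
Proof.
elim: w a b => [|c w IHw] a b; first by rewrite big_ord0.
rewrite big_ord_recl -IHw //.
Qed.

Lemma npeaks_nth w : (npeaks w =
  \sum_(i < size w) [&& 2 <= i, nth 0 w i.-2 < nth 0 w i.-1
                      & nth 0 w i < nth 0 w i.-1])%N.
Proof.
case: w => [|a [|b w]]; rewrite ?big_ord0 ?big_ord1 // npeaks_cons2.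
by rewrite 2!big_ord_recl.
Qed.

Lemma letter_word n (s : {perm 'I_n}) i : (i.-1 < n)%N ->
  letter s i = (nth 0%N (word s) i.-1).+1.
Proof.
by move=> lt_in; rewrite /letter /image_mem (map_comp succn) (nth_map 0%N)
  ?size_word.
Qed.

Lemma card_Peak n (s : {perm 'I_n}) : #|Peak s| = npeaks (word s).
Proof.
rewrite npeaks_nth size_word -sum1_card big_mkcond; apply: eq_bigr => i _.
rewrite inE; case: leqP => //= le2i.
by have lt_in := ltn_ord i; rewrite !letter_word ?ltnS /=; [case: ifP|lia..].
Qed.

(** Peaks are never adjacent and never at either end of the word. *)
Lemma npeaks_size w : w != [::] -> (npeaks w * 2 < size w)%N.
Proof.
have [m] := ubnP (size w); elim: m w => // m IHm [//|a [//|b [//|c w]]] /= ltm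
  _.
have := IHm (c :: w); have := IHm [:: b, c & w] => /=.
case: (ltngtP c b) => cb /=; rewrite ?andbF ?andbT; case: w {IHm} ltm => /=;
  lia.
Qed.

Section PeakPoly.
Variable K : fieldType.
Local Notation vshape := (vshape K).
Local Notation inc w := (mono K true w).

Lemma vshape_nil : vshape [::] = 1.
Proof. by rewrite /vshape conv_nil !mono0 mul1r. Qed.

Lemma vshape1 a : vshape [:: a] = 2%:R.
Proof. by rewrite /vshape conv_cons conv_nil !mono1 !mono0 mul1r. Qed.

Lemma vshape_cons a w :
  vshape (a :: w) = inc (a :: w) + conv (fun u => mono K false (a :: u)) (mono
    K true) w.
Proof. by rewrite /vshape conv_cons mono0 mul1r. Qed.

Lemma vshape_desc a b w : (b < a)%N -> vshape [:: a, b & w] = vshape (b :: w).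
Proof.
move=> lt_ba; rewrite !vshape_cons conv_cons mono1 mul1r mono_cons2 /=.
rewrite ltnNge (ltnW lt_ba) mul0r add0r; congr (_ + _).
by apply: eq_conv => // u _; rewrite mono_cons2 /= lt_ba mul1r.
Qed.

(** After an initial ascent the decreasing factor has length at most 1, and both choices require the
    rest to increase. *)
Lemma vshape_asc a b w : (a < b)%N -> vshape [:: a, b & w] = 2%:R * inc (b ::
  w).
Proof.
move=> lt_ab; rewrite vshape_cons conv_cons mono1 mono_cons2 /= lt_ab !mul1r.
rewrite [X in _ + (_ + X)]big1 ?addr0 ?mulr_natl // => i _.
by rewrite mono_cons2 /= ltnNge (ltnW lt_ab) !mul0r.
Qed.

Lemma vshape_peak a b c w : (a < b)%N -> (c < b)%N -> vshape [:: a, b, c & w] =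
  0.
Proof.
move=> ab cb; rewrite vshape_asc // mono_cons2 /=.
by rewrite ltnNge (ltnW cb) mul0r mulr0.
Qed.

Lemma vshape_nopeak a b c w : a != b -> b != c -> ~~ ((a < b) && (c < b))%N ->
  vshape [:: a, b, c & w] = vshape [:: b, c & w].
Proof.
case: (ltngtP a b) => [ab|ba|//] _; last by rewrite vshape_desc.
by case: (ltngtP b c) => //= bc _ _; rewrite !vshape_asc // mono_cons2 /= bc
  mul1r.
Qed.

Lemma vshape2 a b : a != b -> vshape [:: a; b] = 2%:R.
Proof.
case: (ltngtP a b) => // ab _; first by rewrite vshape_asc // mono1 mulr1.
by rewrite vshape_desc // vshape1.
Qed.

(* The number of factorizations of w into m nonempty V-shaped words, each      *)
(* weighted by 2.                                                              *)
Local Notation vpow := (powconv (nonnil vshape)).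

Lemma vpowS m a w : vpow m.+1 (a :: w) = conv (fun u => vshape (a :: u)) (vpow
  m) w.
Proof.
rewrite -[LHS]/(conv (nonnil vshape) (vpow m) (a :: w)) conv_cons [nonnil _
  [::]]mul0r.
by rewrite mul0r add0r; apply: eq_conv => // u _; rewrite /nonnil mul1r.
Qed.

Lemma vpow0 a w : vpow 0 (a :: w) = 0. Proof. by []. Qed.

(** Generating polynomial of [vpow] by the number of factors. The last entry gives 2X; prepending an
    entry that creates no peak multiplies by 1 + 2X, and prepending two entries that create a peak
    multiplies by 2X (1 + 2X) + 2X = 4X (1 + X). *)
Definition peak_poly n p : {poly K} :=
  2%:R *: 'X * (1 + 2%:R *: 'X) ^+ (n.-1 - p * 2) * ((4%:R *: 'X) * (1 + 'X))
    ^+ p.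

(** The entry [a] is a factor of its own, of weight 2, or joins the factor of [b], whose weight it
    does not change. *)
Lemma vpow_free m a b w : a != b -> b \notin w ->
    (if w is c :: _ then ~~ ((a < b) && (c < b))%N else true) ->
  vpow m.+1 [:: a, b & w] = 2%:R * vpow m (b :: w) + vpow m.+1 (b :: w).
Proof.
move=> ab bw nopeak; rewrite vpowS conv_cons vshape1 vpowS; congr (_ + _).
apply: eq_bigr => i _; congr (_ * _).
case: w bw nopeak i => [|c w] bw nopeak [[|i] lti] /=; rewrite ?vshape1
  ?vshape2 //.
by rewrite vshape_nopeak //; move: bw; rewrite inE; case: eqP.
Qed.

(** A V-shaped factor contains no peak, so the factor starting with [a] stops after [a] or after
    [b]. *)
Lemma vpow_peak m a b c w : (a < b)%N -> (c < b)%N ->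
  vpow m.+1 [:: a, b, c & w] = 2%:R * vpow m [:: b, c & w] + 2%:R * vpow m (c
    :: w).
Proof.
move=> ab cb; rewrite vpowS conv_cons vshape1; congr (_ + _).
rewrite conv_cons vshape2 ?neq_ltn ?ab // -[RHS]addr0; congr (_ + _).
by apply: big1 => i _; rewrite vshape_peak ?mul0r.
Qed.

Lemma peak_polyS n p : (p * 2 < n)%N ->
  peak_poly n.+1 p = (1 + 2%:R *: 'X) * peak_poly n p.
Proof.
case: n => // n ltpn; rewrite /peak_poly /= subSn // exprS -!mulrA.
by rewrite [LHS]mulrCA.
Qed.

Lemma peak_polySS n p : (p * 2 < n)%N ->
  peak_poly n.+2 p.+1 = (4%:R *: 'X) * (1 + 'X) * peak_poly n p.
Proof.
case: n => // n ltpn; rewrite /peak_poly /= mulSn subSS subSS exprS.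
by rewrite [LHS]mulrCA.
Qed.

Lemma vpow_peak_poly w m : uniq w -> w != [::] ->
  vpow m w = (peak_poly (size w) (npeaks w))`_m.
Proof.
have [k] := ubnP (size w); elim: k w m => // k IHk [//|a [|b w]] m.
  move=> _ _ _; rewrite /peak_poly /= !mulr1 coefZ coefX.
  case: m => [|m]; first by rewrite vpow0 mulr0.
  rewrite vpowS conv_nil vshape1 /= /unitw.
  by case: m => [|m]; rewrite ?mulr1 //= conv_nil [nonnil _ [::]]mul0r mul0r
    !mulr0.
rewrite ltnS => ltk uw _.
have /andP[a_nin ubw] : (a \notin b :: w) && uniq (b :: w) := uw.
have /andP[b_nin uniqw] : (b \notin w) && uniq w := ubw.
have nab : a != b by move: a_nin; rewrite inE; case: eqP.
have [nopeak|] := boolP (if w is c :: _ then ~~ ((a < b) && (c < b))%N else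
  true).
  have -> : npeaks [:: a, b & w] = npeaks (b :: w).
    by case: w nopeak {IHk ltk uw a_nin ubw b_nin uniqw} => //= c w /negbTE->.
  rewrite [size _]/= peak_polyS ?(@npeaks_size (b :: w)) //.
  rewrite mulrDl mul1r coefD -scalerAl coefZ coefXM -!(IHk (b :: w)) //.
  case: m => [|m]; first by rewrite !vpow0 mulr0 addr0.
  by rewrite vpow_free // addrC.
case: w ltk uw a_nin ubw b_nin uniqw => // c w ltk uw a_nin ubw b_nin uniqw.
rewrite negbK => /andP[ab cb].
have -> : npeaks [:: a, b, c & w] = (npeaks (c :: w)).+1.
  by rewrite /= ab cb (ltnNge b) (ltnW cb); case: (w).
rewrite [size _]/= peak_polySS ?(@npeaks_size (c :: w)) //.
rewrite mulrDr mulr1 mulrDl coefD -!scalerAl !coefZ -mulrA !coefXM.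
have lt_ck : (size (c :: w) < k)%N by apply: ltn_trans ltk.
rewrite -!(IHk (c :: w)) //.
case: m => [|m]; first by rewrite !vpow0 !mulr0 addr0.
rewrite vpow_peak //=; case: m => [|m]; first by rewrite !vpow0 /=; ring.
(* The peak [b] starts a descent to [c], so it creates no peak in front of [c]. *)
rewrite vpow_free //; first by rewrite /=; ring.
- by rewrite neq_ltn cb orbT.
- by case/andP: uniqw.
- by case: (w) => // d v; rewrite (ltnNge b) (ltnW cb).
Qed.

End PeakPoly.

Lemma galg_scaleE (K : fieldType) (gT : finGroupType) a (x : galg K gT) s :
  (a *: x) s = a * x s.
Proof. by rewrite ffunE. Qed.

Section Peaks.
Variables (K : fieldType) (n : nat).

Lemma sum_geltE (P : pred {perm 'I_n}) t :
  (\sum_(s | P s) gelt K s) t = (P t)%:R.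
Proof.
rewrite sum_ffunE big_mkcond (bigD1 t) //= ffunE eqxx big1 ?addr0 => [|s st].
  by case: ifP.
by case: ifP; rewrite // ffunE eq_sym (negbTE st).
Qed.

Lemma Pi_numE k (s : {perm 'I_n}) : Pi_num K n k s = (#|Peak s| == k)%:R.
Proof. exact: sum_geltE. Qed.

Lemma Pi_setE (P : {set 'I_n}) (s : {perm 'I_n}) : Pi_set K P s = (Peak s ==
  P)%:R.
Proof. exact: sum_geltE. Qed.

Lemma DeltaE (D : {set 'I_n}) s : Delta K D s = (Des s == D)%:R.
Proof. exact: sum_geltE. Qed.

Lemma Pi_num0 : Pi_num K n 0 = Pi_set K set0.
Proof. by apply/ffunP=> s; rewrite Pi_numE Pi_setE cards_eq0. Qed.

Lemma Etilde_sub_Pspace : (Etilde K n <= Pspace K n)%VS.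
Proof.
apply/span_subvP => _ /mapP[k _ ->].
have -> : Pi_num K n k = \sum_(P : {set 'I_n} | #|P| == k) Pi_set K P.
  apply/ffunP=> s; rewrite Pi_numE sum_ffunE.
  under eq_bigr => P _ do rewrite Pi_setE.
  rewrite big_mkcond (bigD1 (Peak s)) //= eqxx big1 ?addr0; first by case: ifP.
  by move=> P; rewrite eq_sym => /negbTE->; case: ifP.
by apply: memv_suml => P _; apply/memv_span/map_f; rewrite mem_enum.
Qed.

Lemma in_Des (s : {perm 'I_n}) (i : 'I_n) : (i \in Des s) =
  (0 < i)%N && (nth 0%N (word s) i < nth 0%N (word s) i.-1)%N.
Proof. by have lt_in := ltn_ord i; rewrite inE !letter_word //=; lia. Qed.

Lemma in_Peak (s : {perm 'I_n}) (i j : 'I_n) : i = j.+1 :> nat ->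
  (i \in Peak s) = [&& 0 < j, i \in Des s & j \notin Des s]%N.
Proof.
have lt_in := ltn_ord i => eq_ij; rewrite !in_Des inE !letter_word ?eq_ij /=;
  [|lia..].
case: (posnP j) => [->|j_gt0] //=; rewrite !ltnS j_gt0.
have : nth 0%N (word s) j.-1 != nth 0%N (word s) j.
  by rewrite nth_uniq ?word_uniq ?size_word; lia.
by case: ltngtP => _ //=; rewrite ?andbT ?andbF.
Qed.

Lemma in_comp_set q (i : 'I_n) :
  reflect (exists2 j, (0 < j < size q)%N & i = sumn (take j q) :> nat)
    (i \in comp_set n q).
Proof.
rewrite inE; apply: (iffP existsP) => [[j /andP[j_gt0 /eqP eq_ij]]|[j
  /andP[j_gt0 ltj] eq_ij]].
  by exists j; rewrite ?j_gt0 /=.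
by exists (Ordinal ltj); rewrite j_gt0 eq_ij /=.
Qed.

Hypothesis n_gt0 : (0 < n)%N.

Lemma word_nonnil (s : {perm 'I_n}) : word s != [::].
Proof. by rewrite -size_eq0 size_word -lt0n. Qed.

Lemma card_Peak_lt (s : {perm 'I_n}) : (#|Peak s| < uphalf n)%N.
Proof. by have := npeaks_size (word_nonnil s); rewrite card_Peak size_word;
  lia. Qed.

Lemma Theta_alt_Pi_num x : Theta K n (x * 2) odd =
  \sum_(k < uphalf n) (\sum_(m < x.+1) 'C(x, m)%:R * (peak_poly K n k)`_m) *:
    Pi_num K n k.
Proof.
apply/ffunP=> s; rewrite Theta_altE sum_ffunE.
rewrite (bigD1 (Ordinal (card_Peak_lt s))) //= [X in _ + X]big1 ?addr0 => [|k
  nk]; last first.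
  rewrite galg_scaleE Pi_numE; case: eqP => [pk|_]; last exact: mulr0.
  by case/eqP: nk; apply/val_inj.
rewrite galg_scaleE Pi_numE eqxx mulr1 (@powconv_nonnil _ _ _ x.+1) ?vshape_nil
  //.
apply: eq_bigr => m _; rewrite vpow_peak_poly ?word_uniq ?word_nonnil //.
by rewrite size_word card_Peak.
Qed.

Lemma Theta_alt_in_Etilde x : Theta K n (x * 2) odd \in Etilde K n.
Proof.
rewrite Theta_alt_Pi_num memv_suml // => k _; apply/memvZ/memv_span/map_f.
by rewrite mem_iota /=; have := ltn_ord k; lia.
Qed.

Lemma dim_Etilde_le : (\dim (Etilde K n) <= uphalf n)%N.
Proof.
have sub : (Etilde K n <= <<[seq Pi_num K n k | k <- iota 0 (uphalf n)]>>)%VS.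
  apply/span_subvP => _ /mapP[k _ ->]; have [lt_kn|le_nk] := ltnP k (uphalf n).
    by apply/memv_span/map_f; rewrite mem_iota.
  have -> : Pi_num K n k = 0; last exact: mem0v.
  apply/ffunP=> s; rewrite Pi_numE ffunE; case: eqP => // eq_k.
  by have := card_Peak_lt s; rewrite eq_k ltnNge le_nk.
apply: leq_trans (dimvS sub) _; apply: leq_trans (dim_span _) _.
by rewrite size_map size_iota.
Qed.

(** For x = 1 only the coefficients of degree at most 1 of the peak polynomial enter, and X^2
    divides it as soon as there is a peak. *)
Lemma Xi_tilde_Theta : Xi_tilde K n = Theta K n 2 odd.
Proof.
apply/ffunP=> s; rewrite -[2%N]mul1n Theta_altE galg_scaleE Pi_setE.
rewrite (@powconv_nonnil _ _ _ 2%N) ?vshape_nil // !big_ord_recl big_ord0 addr0.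
rewrite !vpow_peak_poly ?word_uniq ?word_nonnil // size_word -card_Peak !mul1r.
rewrite /peak_poly -!mulrA -!scalerAl !coefZ !coefXM /= mulr0 add0r.
rewrite -cards_eq0 -horner_coef0; case: #|_| => [|p].
  by rewrite expr0 mulr1 horner_exp !hornerE expr1n mulr1.
by rewrite exprS !hornerM hornerZ hornerM hornerX !(mul0r, mulr0).
Qed.

(** Without peaks a descent at a position i > 1 forces one at i - 1, so the descents form an initial
    segment. *)
Lemma Peak_set0P (s : {perm 'I_n}) :
  reflect (exists2 k, (k < n)%N & Des s = [set i : 'I_n | 1 <= i <= k]%N)
    (Peak s == set0).
Proof.
apply: (iffP eqP) => [noPeak|[k lt_kn Des_s]]; last first.
  apply/setP=> i; rewrite in_set0; apply/negP; case: (posnP i) => [i0|i_gt0].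
    by rewrite inE i0.
  have lt_jn : (i.-1 < n)%N by have := ltn_ord i; lia.
  rewrite (@in_Peak s i (Ordinal lt_jn)) /= ?prednK // Des_s !inE /=; lia.
have down (i j : 'I_n) : i \in Des s -> (0 < j <= i)%N -> j \in Des s.
  move=> Di /andP[j_gt0 le_ji]; move: {2}(i - j)%N (erefl (i - j)%N) => d.
  elim: d j j_gt0 le_ji => [|d IHd] j j_gt0 le_ji eq_d.
    by rewrite (_ : j = i) //; apply/val_inj => /=; lia.
  have lt_jn : (j.+1 < n)%N by have := ltn_ord i; lia.
  have := @in_Peak s (Ordinal lt_jn) j erefl.
  rewrite noPeak inE j_gt0 IHd /=; [|lia..].
  by move/esym/negbFE.
have [D0|[i0 Di0]] := set_0Vmem (Des s).
  by exists 0%N => //; apply/setP=> i; rewrite D0 !inE; lia.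
have [i Di maxi] := @arg_maxnP _ i0 (mem (Des s)) val Di0.
exists i => //; apply/setP=> j; rewrite [RHS]inE; apply/idP/idP =>
  [Dj|/down->//].
by rewrite [(j <= i)%N]maxi // andbT; move: Dj; rewrite in_Des; case/andP.
Qed.

Lemma comp_set_hook k : (k < n)%N ->
  comp_set n (nseq k 1%N ++ [:: n - k]%N) = [set i : 'I_n | 1 <= i <= k]%N.
Proof.
move=> lt_kn; have hook j : (j <= k)%N -> sumn (take j (nseq k 1%N ++ [:: n -
  k]%N)) = j.
  by move=> le_jk; rewrite takel_cat ?size_nseq // take_nseq // sumn_nseq mul1n.
apply/setP=> i; rewrite [RHS]inE; apply/in_comp_set/idP => [[j]|].
  by rewrite size_cat size_nseq addn1 ltnS => /andP[j0 le_jk] ->; rewrite hook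
    ?j0.
by case/andP=> i0 le_ik; exists i; rewrite ?hook // size_cat size_nseq addn1 i0.
Qed.

Lemma Pi_set0 : Pi_set K set0 =
  \sum_(0 <= k < n) Delta K (comp_set n (nseq k 1%N ++ [:: n - k]%N)).
Proof.
apply/ffunP=> s; rewrite Pi_setE big_mkord sum_ffunE.
under eq_bigr => k _ do rewrite comp_set_hook // DeltaE.
have [[k lt_kn Des_s]|Ds] := Peak_set0P s; last first.
  by rewrite big1 // => k _; case: eqP => // Des_s; case: Ds; exists k.
rewrite (bigD1 (Ordinal lt_kn)) //= Des_s eqxx big1 ?addr0 // => j.
rewrite -val_eqE /= => jk; case: eqP => // /setP eq_kj.
(* The larger of [j] and [k] lies in only one of the two segments. *)
have lt_jn := ltn_ord j; have lt_mn : (maxn j k < n)%N by lia.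
by have := eq_kj (Ordinal lt_mn); rewrite !inE /=; lia.
Qed.
End Peaks.

(** * Compositions and the elements rho *)

(** Listing compositions as plain words lets sums be rearranged across different degrees without
    dependent types. *)
Definition comps n : seq (seq nat) := [seq comp_word q | q : composition n].

Lemma mem_comps n w : (w \in comps n) = is_comp n w.
Proof.
apply/imageP/idP => [[q _ ->]|/comp_wordP[q ->]]; first exact: (valP q).
by exists q.
Qed.

Lemma comps_uniq n : uniq (comps n).
Proof. by rewrite map_inj_uniq ?enum_uniq //; apply: comp_word_inj. Qed.

Lemma sum_comps (V : nmodType) n (P : pred (seq nat)) (F : seq nat -> V) :
  \sum_(q : composition n | P q) F q = \sum_(w <- comps n | P w) F w.
Proof. by rewrite big_image_cond; apply: eq_bigl => q. Qed.

Lemma is_comp_cons n a w :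
  is_comp n (a :: w) = (0 < a <= n)%N && is_comp (n - a) w.
Proof.
rewrite /is_comp /= inE negb_or; case: (0%N \notin w); rewrite ?andbF ?andbT //.
by case: eqP; case: a => //= a; case: eqP => //; lia.
Qed.

Lemma is_comp_cat m n v w : sumn v = m -> is_comp (m + n) (v ++ w) = is_comp m
  v && is_comp n w.
Proof.
move=> vm; rewrite /is_comp sumn_cat mem_cat negb_or vm eqxx eqn_add2l.
by rewrite !andTb andbCA.
Qed.

Lemma comps_recl n k : perm_eq [seq w <- comps n | size w == k.+1]
  [seq i :: v | i <- iota 1 n, v <- [seq v <- comps (n - i) | size v == k]].
Proof.
apply: uniq_perm.
- exact/filter_uniq/comps_uniq.
- apply: allpairs_uniq_dep => [|i _|[i v] [j w] _ _ [-> ->]//]; first exact: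
  iota_uniq.
  exact/filter_uniq/comps_uniq.
move=> w; rewrite mem_filter mem_comps; apply/andP/allpairsPdep => [[]|].
  case: w => // a v; rewrite is_comp_cons => sz /andP[a_bd cv]; exists a, v.
  by rewrite mem_iota add1n ltnS a_bd mem_filter mem_comps cv andbT.
case=> a [v [a_in]]; rewrite mem_filter mem_comps => /andP[/eqP <- cv] ->.
by rewrite is_comp_cons cv andbT; split=> //; move: a_in; rewrite mem_iota
  add1n ltnS.
Qed.

Lemma sum_comps_recl (V : nmodType) n k (F : seq nat -> V) :
  \sum_(w <- comps n | size w == k.+1) F w =
  \sum_(1 <= i < n.+1) \sum_(v <- comps (n - i) | size v == k) F (i :: v).
Proof.
rewrite -big_filter (perm_big _ (comps_recl n k)) big_allpairs_dep /=
  /index_iota subn1.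
by apply: eq_bigr => i _; rewrite big_filter.
Qed.

(** Concatenation is undone by marking, in a composition of m + n, a cut before which the parts add
    up to m. *)
Lemma sum_comps_cat (V : nmodType) m n (F : seq nat -> seq nat -> V) :
  \sum_(v <- comps m) \sum_(w <- comps n) F v w =
  \sum_(t <- comps (m + n)) \sum_(0 <= j < (size t).+1 | sumn (take j t) == m)
     F (take j t) (drop j t).
Proof.
pose cutat t := [seq j <- iota 0 (size t).+1 | sumn (take j t) == m].
have : perm_eq [seq (v, w) | v <- comps m, w <- comps n]
               [seq (take j t, drop j t) | t <- comps (m + n), j <- cutat t].
  apply: uniq_perm.
  - by apply: allpairs_uniq => [||[? ?] [? ?]]; rewrite ?comps_uniq.
  - apply: allpairs_uniq_dep => [|t _|]; [exact:
    comps_uniq|exact/filter_uniq/iota_uniq|].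
    move=> [t j] [t' j'] /allpairsPdep[t1 [j1 [_ jt [-> ->]]]] /allpairsPdep[t2
      [j2 [_ jt' [-> ->]]]] /=.
    move: jt jt'; rewrite !mem_filter !mem_iota !add0n !ltnS /=.
    move=> /andP[_ le1] /andP[_ le2] [eq_take eq_drop].
    have -> : t1 = t2 by rewrite -(cat_take_drop j1 t1) eq_take eq_drop
      cat_take_drop.
    by move/(congr1 size): eq_take; rewrite !size_takel // => ->.
  case=> v w; apply/allpairsP/allpairsPdep => [[[v' w'] /= [cv cw [-> ->]]]|].
    exists (v' ++ w'), (size v'); rewrite take_size_cat // drop_size_cat //.
    move: cv cw; rewrite !mem_comps => cv cw.
    rewrite is_comp_cat ?cv ?cw; last by case/andP: cv => /eqP.
    by rewrite mem_filter mem_iota take_size_cat // size_cat ltnS !leq_addr;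
      case/andP: cv => ->.
  case=> t [j [ct]]; rewrite mem_filter => /andP[/eqP tm _] [-> ->].
  exists (take j t, drop j t); rewrite !mem_comps.
  by move: ct; rewrite mem_comps -{1}[t](cat_take_drop j) is_comp_cat // =>
    /andP[-> ->].
move=> eq_cat; have := perm_big _ eq_cat (P := xpredT)
  (F := fun p => F p.1 p.2) (op := @GRing.add V) (x := 0).
rewrite big_allpairs big_allpairs_dep /= => ->.
by apply: eq_bigr => t _; rewrite big_filter.
Qed.

Fixpoint cuts (q : seq nat) : seq nat :=
  if q is a :: q' then if nilp q' then [::] else a :: map (addn a) (cuts q')
    else [::].

Lemma cutsE q : cuts q = [seq sumn (take j q) | j <- iota 1 (size q).-1].
Proof.
elim: q => // a [|b q] // IHq; rewrite [cuts _]/= -/(cuts (b :: q)) IHq /=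
  addn0.
by congr (_ :: _); rewrite (iotaDl 1 1) -!map_comp.
Qed.

Lemma in_comp_set_cuts n q (i : 'I_n) : (i \in comp_set n q) = (val i \in cuts
  q).
Proof.
rewrite cutsE; apply/in_comp_set/mapP => [[j /andP[j0 ltj] ij]|[j jq ij]].
  by exists j; rewrite // mem_iota; lia.
by exists j; move: jq; rewrite // mem_iota; lia.
Qed.

Lemma cuts_ge a q i : i \in cuts (a :: q) -> (a <= i)%N.
Proof.
rewrite /=; case: nilP => // _; rewrite inE => /orP[/eqP->//|/mapP[j _ ->]].
exact: leq_addr.
Qed.

(** The smallest cut is the first part, and the remaining cuts are those of the tail, shifted. *)
Lemma cuts_inj n p q : is_comp n p -> is_comp n q -> cuts p =i cuts q -> p = q.
Proof.
elim: p n q => [|a p IHp] n [|b q] //; rewrite ?is_comp_cons.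
- by case/andP=> /= /eqP<- _ /andP[/andP[]]; case: b.
- by move=> /andP[/andP[a0 an] _] /andP[/= /eqP n0]; exfalso; lia.
move=> /andP[/andP[a0 an] cp] /andP[/andP[b0 bn] cq] eq_pq.
have first_cut c r d s : is_comp (n - d) s -> (c < d <= n)%N -> is_comp (n - c)
  r ->
    cuts (c :: r) =i cuts (d :: s) -> False.
  move=> _ /andP[cd dn] cr eq_rs.
  have : c \in cuts (c :: r).
    rewrite /=; case: nilP => [r0|_]; last exact: mem_head.
    by move: cr; rewrite r0 /is_comp /= andbT eq_sym subn_eq0 leqNgt; lia.
  by rewrite eq_rs => /cuts_ge; rewrite leqNgt cd.
have ab : a = b.
  case: (ltngtP a b) => // [ab|ba].
    by case: (first_cut a p b q cq _ cp eq_pq); rewrite ab.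
  by case: (first_cut b q a p cp _ cq) => [|i]; rewrite ?ba ?eq_pq.
subst b; congr (_ :: _); apply: (IHp (n - a)%N) => // i.
have := eq_pq (a + i)%N; rewrite /=; case: nilP => [p0|_]; case: nilP => [q0|_].
- by rewrite p0 q0.
- move: cp; rewrite p0 /is_comp /= andbT eq_sym => /eqP na.
  by move: cq; rewrite na /is_comp; case: (q) => // c r /andP[/eqP] /=; case: c.
- move: cq; rewrite q0 /is_comp /= andbT eq_sym => /eqP na.
  by move: cp; rewrite na /is_comp; case: (p) => // c r /andP[/eqP] /=; case: c.
rewrite !inE !(mem_map (@addnI a)) -[X in _ == X]addn0 eqn_add2l.
case: i => // _.
have no0 r m : is_comp m r -> (0%N \in cuts r) = false.
  case: r => // c r; rewrite is_comp_cons => /andP[/andP[c0 _] _].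
  by apply/negP=> /cuts_ge; rewrite leqNgt c0.
by rewrite (no0 _ _ cp) (no0 _ _ cq).
Qed.

Lemma cuts_bound n q i : is_comp n q -> i \in cuts q -> (0 < i < n)%N.
Proof.
elim: q n i => // a q IHq n i; rewrite is_comp_cons => /andP[/andP[a0 an] cq]
  /=.
have qn : nilp q = false -> (a < n)%N.
  move: cq; rewrite /is_comp; case: (q) => // c r /andP[/eqP sq c0] _.
  by rewrite -subn_gt0 -sq; case: (c) c0.
case: nilP qn => //= _ /(_ erefl) lt_an; rewrite inE => /orP[/eqP->|/mapP[j jq
  ->]].
  by rewrite a0 lt_an.
by have := IHq _ _ cq jq; lia.
Qed.

(** * The basis Xi and its description by increasing blocks *)

Section XiBasis.
Variables (K : fieldType) (n : nat).

Lemma Xi_setE (D : {set 'I_n}) s : Xi_set K D s = (Des s \subset D)%:R.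
Proof.
rewrite sum_ffunE; under eq_bigr => E _ do rewrite DeltaE.
rewrite big_mkcond (bigD1 (Des s)) //= eqxx big1 ?addr0 => [|E]; first by case:
  ifP.
by rewrite eq_sym => /negbTE->; case: ifP.
Qed.

Lemma exists_Des (D : {set 'I_n}) : (forall i : 'I_n, i \in D -> 0 < i)%N ->
  exists s : {perm 'I_n}, Des s = D.
Proof.
(* [block i] is the number of elements of [D] up to [i]. Later blocks receive smaller values and
   each block increases, so descents occur exactly where a block starts. *)
move=> D_gt0; pose block (i : nat) := #|[set d in D | (d <= i)%N]|.
pose k (i : 'I_n) := (n - block i, val i)%N.
have [s sP] : exists s : {perm 'I_n}, forall i j, (s i < s j)%N = keylt xpredT
  (k i) (k j).
  apply: (@standardization _ (fun i j => keylt xpredT (k i) (k j))).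
  - by move=> i; apply: keylt_irr.
  - by move=> i j l; apply: keylt_trans.
  - by move=> i j; rewrite -val_eqE => ij; apply: keylt_total.
exists s; apply/setP=> i; rewrite in_Des; case: (posnP i) => [i0|i_gt0] /=.
  by apply/esym/negP => /D_gt0; rewrite i0.
have lt_jn : (i.-1 < n)%N by have := ltn_ord i; lia.
rewrite -[i.-1]/(val (Ordinal lt_jn)) !nth_word sP /keylt /=.
have le_bn j : (block j <= n)%N by rewrite -[leqRHS]card_ord max_card.
have eq_bi : block i = ((i \in D) + block i.-1)%N.
  rewrite /block (cardsD1 i) inE leqnn andbT; congr (_ + _)%N.
  by apply: eq_card => j; rewrite !inE -val_eqE /=; case: (j \in D) => /=; lia.
have := le_bn i; rewrite eq_bi; case: (i \in D) => /=; lia.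
Qed.

Lemma XiE q s : Xi K n q s = (Des s \subset comp_set n q)%:R.
Proof. exact: Xi_setE. Qed.

(** Triangularity: at a permutation with descent set D(q) only those r with D(r) containing D(q)
    contribute, so the coefficients vanish by induction from the largest sets downwards. *)
Lemma Xi_free (a : composition n -> K) :
  \sum_(q : composition n) a q *: Xi K n q = 0 -> forall q, a q = 0.
Proof.
move=> sum0 q; have [m] := ubnP (n - #|comp_set n q|); elim: m q => // m IHm q
  ltm.
have [|s Des_s] := @exists_Des (comp_set n q).
  by move=> i; rewrite in_comp_set_cuts => /(cuts_bound (valP q)) /andP[].
have /ffunP/(_ s) := sum0; rewrite sum_ffunE ffunE.
rewrite (bigD1 q) //= galg_scaleE XiE Des_s subxx mulr1 big1 ?addr0 // => r rq.
rewrite galg_scaleE XiE Des_s; case: (boolP (_ \subset _)) => [sub|]; last by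
  rewrite mulr0.
rewrite IHm ?mul0r //; suff /proper_card : comp_set n q \proper comp_set n
  (comp_word r).
  by have := subset_leq_card (subsetT (comp_set n (comp_word r))); rewrite
    cardsT card_ord; lia.
rewrite properEneq sub andbT; apply: contraNneq rq => eq_qr.
apply/eqP/comp_word_inj/(cuts_inj (valP r) (valP q)) => i.
have [lt_in|le_ni] := ltnP i n.
  by have /setP/(_ (Ordinal lt_in)) := eq_qr; rewrite !in_comp_set_cuts.
have big p : is_comp n p -> (i \in cuts p) = false.
  by move=> cp; apply/negP => /(cuts_bound cp); lia.
by rewrite (big _ (valP r)) (big _ (valP q)).
Qed.

End XiBasis.

Section Coordinates.
Variables (K : fieldType) (V : vectType K) (I : finType) (b : I -> V).

Lemma fcoord_sum (a : I -> K) j :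
  (forall a : I -> K, \sum_i a i *: b i = 0 -> forall i, a i = 0) ->
  fcoord b j (\sum_i a i *: b i) = a j.
Proof.
move=> b_free; set t := [tuple b (enum_val k) | k < #|I|].
have free_t : free t.
  apply/freeP => k; rewrite (reindex enum_rank) /=; last
    exact/onW_bij/enum_rank_bij.
  move=> sum0 i; rewrite -(enum_valK i); apply: (b_free (fun i => k (enum_rank
    i))).
  rewrite -[RHS]sum0; apply: eq_bigr => i' _.
  by rewrite (nth_map (enum_rank i')) ?size_enum_ord // nth_ord_enum enum_rankK.
rewrite /fcoord -/t.
have -> : \sum_i a i *: b i = \sum_(k < #|I|) a (enum_val k) *: t`_k.
  rewrite [RHS](reindex enum_rank) /=; last exact/onW_bij/enum_rank_bij.
  apply: eq_bigr => i _.
  by rewrite (nth_map (enum_rank i)) ?size_enum_ord // nth_ord_enum enum_rankK.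
by rewrite coord_sum_free // enum_rankK.
Qed.

End Coordinates.

Lemma star_sum (K : fieldType) m n (a : seq nat -> K) (b : seq nat -> K) :
  star (\sum_(r : composition m) a r *: Xi K m r) (\sum_(q : composition n) b q
    *: Xi K n q) =
  \sum_(r : composition m) \sum_(q : composition n) (a r * b q) *: Xi K (m + n)
    (r ++ q).
Proof.
apply: eq_bigr => r _; apply: eq_bigr => q _.
rewrite (fcoord_sum (a : composition m -> K)); last exact: Xi_free.
by rewrite (fcoord_sum (b : composition n -> K)) //; apply: Xi_free.
Qed.

Section Blocks.
Variable K : fieldType.
Local Notation mono := (mono K).

Definition blk b a w : K := (size w == a)%:R * mono b w.

Definition blocks (u : seq (bool * nat)) :=
  foldr (fun p F => conv (blk p.1 p.2) F) (unitw K) u.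

Lemma conv_blk b a F w : conv (blk b a) F w =
  if (a <= size w)%N then mono b (take a w) * F (drop a w) else 0.
Proof.
case: leqP => [le_aw|lt_wa]; last first.
  apply: big1 => i _; rewrite /blk size_takel; last by rewrite -ltnS.
  by case: eqP => [ia|_]; rewrite ?mul0r //; have := ltn_ord i; lia.
have lt_aw : (a < (size w).+1)%N by [].
rewrite /conv (bigD1 (Ordinal lt_aw)) //= /blk size_takel // eqxx mul1r.
rewrite big1 ?addr0 // => i; rewrite -val_eqE /= => /negbTE ia.
by rewrite size_takel ?ia ?mul0r // -ltnS.
Qed.

Definition cut_descents (q w : seq nat) := all
  (fun i => (nth 0 w i < nth 0 w i.-1) ==> (i \in cuts q))%N (iota 1 (size
    w).-1).

Lemma cut_descentsP (q w : seq nat) : reflect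
  (forall i, 0 < i < size w -> nth 0 w i < nth 0 w i.-1 -> i \in cuts q)%N
  (cut_descents q w).
Proof.
apply: (iffP allP) => [H i i_w|H i i_w]; last first.
  by apply/implyP/H; move: i_w; rewrite mem_iota; lia.
by apply/implyP/H; rewrite mem_iota; lia.
Qed.

Lemma blocks_pos (q w : seq nat) : uniq w -> is_comp (size w) q ->
  blocks [seq (true, a) | a <- q] w = (cut_descents q w)%:R.
Proof.
elim: q w => [|a q IHq] w uw.
  by case/andP=> /= /eqP/esym/size0nil-> _.
rewrite is_comp_cons => /andP[/andP[a0 an] cq] /=.
rewrite conv_blk an IHq ?size_drop ?drop_uniq // -natrM mulnb; congr
  (nat_of_bool _)%:R.
have cutsE : cuts (a :: q) = if (a < size w)%N then a :: map (addn a) (cuts q)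
  else [::].
  rewrite /=; case: nilP => [q0|].
    by move: cq; rewrite q0 /is_comp /= andbT eq_sym subn_eq0 leqNgt =>
      /negbTE->.
  move: cq; rewrite /is_comp; case: (q) => // c r /andP[/eqP sq c0] _.
  by rewrite -subn_gt0 -sq; case: (c) c0.
have desc i : (0 < i < size w)%N -> (nth 0 w i < nth 0 w i.-1)%N = ~~ (nth 0 w
  i.-1 < nth 0 w i)%N.
  move=> iw; have /andP[i0 lt_iw] := iw.
  have : nth 0%N w i != nth 0%N w i.-1.
    rewrite nth_uniq ?neq_ltn ?ltn_predL ?i0 ?orbT //.
    exact: leq_ltn_trans (leq_pred i) lt_iw.
  by case: ltngtP.
apply/idP/cut_descentsP => [/andP[inc_a /cut_descentsP desc_q] i iw di|desc_w].
  have /andP[i0 lt_iw] := iw.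
  rewrite cutsE; have lt_ia : (a <= i)%N.
    rewrite leqNgt; apply/negP => lt_ia; move: di; rewrite desc //.
    move/sortedP: inc_a => /(_ 0%N i.-1); rewrite prednK ?size_takel //.
    by rewrite !nth_take //; [move=> /= ->|lia].
  rewrite (leq_ltn_trans lt_ia lt_iw).
  rewrite inE; case: eqP => //= ai; rewrite -(subnKC lt_ia) mem_map; last
    exact: addnI.
  apply: desc_q; rewrite ?size_drop; first by lia.
  rewrite !nth_drop subnKC // (_ : (a + (i - a).-1 = i.-1)%N) //; lia.
apply/andP; split.
  apply/(sortedP 0%N) => i; rewrite size_takel // => lt_ia; rewrite !nth_take
    //; last exact: ltnW.
  rewrite /ltn /= -[(_ < _)%N]negbK -(desc i.+1) //=; last by lia.
  apply/negP => di; have iw : (0 < i.+1 < size w)%N by rewrite (leq_trans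
    lt_ia).
  have := desc_w _ iw di; rewrite cutsE; case: ifP => // _.
  rewrite inE => /orP[/eqP eq_ia|/mapP[j _ eq_ia]]; move: lt_ia; rewrite eq_ia
    ?ltnn //.
  by rewrite ltnNge leq_addr.
apply/cut_descentsP => i; rewrite size_drop => iw; rewrite !nth_drop => di.
have : (a + i)%N \in cuts (a :: q).
  by apply: desc_w; [lia | rewrite (_ : (a + i).-1 = (a + i.-1)%N) //; lia].
rewrite cutsE; case: ifP => // _; rewrite inE => /orP[/eqP|]; first by lia.
by rewrite mem_map //; apply: addnI.
Qed.

(** The descents of [s] lie in D(q) exactly when its word is a sequence of increasing blocks with
    lengths the parts of q. *)
Lemma Xi_blocks n q s : is_comp n q ->
  Xi K n q s = blocks [seq (true, a) | a <- q] (word s).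
Proof.
move=> cq; rewrite XiE blocks_pos ?word_uniq ?size_word //; congr (nat_of_bool
  _)%:R.
apply/subsetP/cut_descentsP => [sub i|H i].
  rewrite size_word => /andP[i0 lt_in] di.
  by have := sub (Ordinal lt_in); rewrite in_Des in_comp_set_cuts /= i0 di =>
    ->.
by rewrite in_Des in_comp_set_cuts => /andP[i0 di]; apply: H; rewrite //
  size_word i0 ltn_ord.
Qed.

Lemma powconv_blocks m w :
  powconv (nonnil (mono true)) m w =
  \sum_(q <- comps (size w) | size q == m) blocks [seq (true, a) | a <- q] w.
Proof.
elim: m w => [|m IHm] w.
  case: w => [|x w].
    have eq0 : perm_eq (comps 0) [:: [::]].
      apply: uniq_perm; rewrite ?comps_uniq // => -[|a q]; rewrite mem_comps //
        is_comp_cons.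
      by case: a.
    by rewrite (perm_big _ eq0) big_mkcond big_seq1.
  by rewrite big1_seq // => -[|a q] // /andP[_]; rewrite mem_comps.
rewrite sum_comps_recl -[LHS]/(conv (nonnil (mono true)) (powconv (nonnil (mono
  true)) m) w) /conv.
rewrite -(big_mkord xpredT (fun i => nonnil (mono true) (take i w) * powconv _
  m (drop i w))).
rewrite big_ltn // take0 [nonnil _ [::]]mul0r mul0r add0r.
apply: eq_big_nat => i /andP[i0 lt_iw]; rewrite IHm size_drop big_distrr /=.
apply: eq_bigr => q _; rewrite /= conv_blk -[(i <= size w)%N]/(i < (size
  w).+1)%N lt_iw /nonnil.
by rewrite -size_eq0 size_takel // -lt0n i0 mul1r.
Qed.

(** The sizes of the nonempty fibres form a composition q, and the letters actually used can be
    chosen in 'C(x, size q) ways. *)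
Lemma Theta_pos_Xi n x : Theta K n x xpredT =
  \sum_(q : composition n) 'C(x, size q)%:R *: Xi K n q.
Proof.
apply/ffunP=> s; rewrite Theta_posE sum_ffunE.
(* The bound must exceed both x, for the binomial theorem, and every [size q], which is at most
   n. *)
rewrite (@powconv_nonnil _ _ _ (maxn x n).+1) ?mono0 ?ltnS ?leq_maxl //.
under eq_bigr => m _ do rewrite powconv_blocks size_word -sum_comps big_distrr
  /=.
rewrite [RHS](partition_big (fun q : composition n => inord (size q) : 'I_(maxn
  x n).+1) xpredT) //=.
apply: eq_bigr => m _.
have size_q (q : composition n) : (size q < (maxn x n).+1)%N.
  rewrite size_map ltnS; apply: leq_trans (leq_maxr _ _); exact: size_bseq.
rewrite [LHS]big_mkcond [RHS]big_mkcond; apply: eq_bigr => q _.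
rewrite -[in RHS]val_eqE /= inordK //.
by case: eqP => // <-; rewrite galg_scaleE Xi_blocks //; apply: (valP q).
Qed.

End Blocks.

(** * The elements rho and the logarithm *)

Section Rho.
Variable K : fieldType.

(** The coefficient of z^j in log (1 + z); for j = 0 it is 0 because the inverse of 0 is 0. *)
Definition logc (j : nat) : K := (-1) ^+ j.-1 / j%:R.

Lemma logc0 : logc 0 = 0. Proof. by rewrite /logc invr0 mulr0. Qed.

(** The coefficient of Xi t in [rho_word q]: [t] is cut into factors whose sums are the parts of
    [q], a factor with j parts having weight [logc j]. *)
Fixpoint rho_coef (q t : seq nat) : K :=
  if q is m :: q' then
    \sum_(0 <= j < (size t).+1 | sumn (take j t) == m) logc j * rho_coef q'
      (drop j t)
  else (t == [::])%:R.

Lemma rho_wordE q :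
  rho_word K q = \sum_(t : composition (sumn q)) rho_coef q t *: Xi K (sumn q)
    t.
Proof.
elim: q => [|m q IHq].
  rewrite (@sum_comps _ _ xpredT (fun t => rho_coef [::] t *: Xi K 0 t)).
  rewrite (bigD1_seq [::]) ?comps_uniq ?mem_comps //= scale1r big1 ?addr0 // =>
    t.
  by move=> /negbTE /= ->; rewrite scale0r.
rewrite [LHS]/= IHq [rho K m](_ : _ =
  \sum_(r : composition m) (logc \o size) (comp_word r) *: Xi K m r) //.
rewrite star_sum /=.
rewrite (@sum_comps _ _ xpredT (fun r => \sum_(t : composition (sumn q))
  (logc (size r) * rho_coef q t) *: Xi K (m + sumn q) (r ++ t))).
under eq_bigr => r _ do rewrite (@sum_comps _ _ xpredT
  (fun t => (logc (size r) * rho_coef q t) *: Xi K (m + sumn q) (r ++ t))).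
rewrite sum_comps_cat.
rewrite [RHS](@sum_comps _ _ xpredT (fun t => rho_coef (m :: q) t *: Xi K (m +
  sumn q) t)).
apply: eq_bigr => t _; rewrite scaler_suml big_mkcond [RHS]big_mkcond /=.
apply: eq_big_nat => j /andP[_ le_jt]; case: ifP => // _.
by rewrite size_takel // cat_take_drop.
Qed.

Lemma ecast_Xi m n (e : m = n) (f : seq nat -> K) :
  ecast i (KS K i) e (\sum_(t : composition m) f t *: Xi K m t) =
  \sum_(t : composition n) f t *: Xi K n t.
Proof. by case: n / e. Qed.

Definition logp N : {poly K} := \poly_(j < N.+1) logc j.

(** A cut of [t] into k factors determines their sums, that is, [q]. Summing over [q] leaves a free
    choice of k factor lengths weighted by [logc], which is a coefficient of the k-th power of the
    logarithm. *)
Lemma sum_rho_coef N k n t : is_comp n t -> (size t <= N)%N ->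
  \sum_(q <- comps n | size q == k) rho_coef q t = (logp N ^+ k)`_(size t).
Proof.
elim: k n t => [|k IHk] n t ct le_tN.
  rewrite expr0 coef1; case: n ct => [|n] ct.
    rewrite big_mkcond (bigD1_seq [::]) ?comps_uniq ?mem_comps //= size_eq0.
    by rewrite big1 ?addr0 // => -[|a q].
  rewrite big1_seq => [|[|a q] /andP[//_]]; last by rewrite mem_comps.
  by case: t ct le_tN.
rewrite sum_comps_recl exprS coefM.
rewrite (eq_bigr (fun i => \sum_(0 <= j < (size t).+1 | sumn (take j t) == i)
   logc j * \sum_(v <- comps (n - i) | size v == k) rho_coef v (drop j t)));
     last first.
  by move=> i _; rewrite /= [LHS]exchange_big; apply: eq_bigr => j _; rewrite
    big_distrr.
under eq_bigr => i _ do rewrite big_mkcond.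
rewrite exchange_big /= -(big_mkord xpredT (fun j => (logp N)`_j * (logp N ^+
  k)`_(size t - j))).
apply: eq_big_nat => j /andP[_ le_jt]; rewrite coef_poly.
have [/eqP nt t0] := andP ct.
have cd : is_comp (n - sumn (take j t)) (drop j t).
  rewrite -nt -{1}(cat_take_drop j t) sumn_cat addKn /is_comp eqxx /=.
  by apply: contra t0 => /mem_drop.
case: (posnP j) => [->|j0].
  rewrite logc0 /= mul0r big1 // => i _.
  by case: eqP; rewrite ?mul0r.
have lt_jN : (j < N.+1)%N by lia.
rewrite lt_jN -size_drop -(IHk _ _ cd); last by rewrite size_drop; lia.
rewrite (bigD1_seq (sumn (take j t))) ?iota_uniq //=.
  by rewrite eqxx [X in _ + X]big1 ?addr0 // => i; rewrite eq_sym => /negbTE->.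
rewrite mem_index_iota ltnS -nt -{3}[t](cat_take_drop j) sumn_cat leq_addr
  andbT.
case: t t0 j0 {nt ct cd le_tN} le_jt => [|a t]; case: j lt_jN => // j _.
by rewrite inE negb_or => /andP[a0 _] _ _ /=; rewrite addn_gt0 lt0n eq_sym a0.
Qed.

Lemma rho_numE n k :
  rho_num K n k = \sum_(q : composition n) ((k`!%:R)^-1 * (logp n ^+ k)`_(size
    q)) *: Xi K n q.
Proof.
rewrite /rho_num; under eq_bigr => q _ do rewrite rho_wordE ecast_Xi.
rewrite exchange_big scaler_sumr; apply: eq_bigr => t _ /=.
rewrite -scaler_suml scalerA; congr (_ * _ *: _).
rewrite (@sum_comps _ _ (fun q => size q == k) (fun q => rho_coef q (comp_word
  t))).
by rewrite (@sum_rho_coef n k n (comp_word t) (valP t)) // size_map size_bseq.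
Qed.

Hypothesis charK0 : [pchar K] =i pred0.

Lemma natK_eq0 m : (m%:R == 0 :> K) = (m == 0)%N.
Proof. exact: ((GRing.pcharf0P K).1 charK0). Qed.

Lemma natK_neq0 m : (0 < m)%N -> m%:R != 0 :> K.
Proof. by rewrite natK_eq0 lt0n. Qed.

Section Stirling.
Variable n : nat.
Let c k m : K := (k`!%:R)^-1 * (logp n ^+ k)`_m.

Lemma logp_coef_small k m : (m < k)%N -> (logp n ^+ k)`_m = 0.
Proof.
move=> ltmk; have -> : logp n = 'X * \poly_(j < n) logc j.+1.
  apply/polyP=> -[|j]; rewrite coef_poly coefXM /= ?logc0 //.
  by rewrite ltnS coef_poly.
by rewrite exprMn coefXnM ltmk.
Qed.

(* (1 + z) d/dz log(1 + z)^(k+1) = (k+1) log(1 + z)^k                          *)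
Lemma logp_coef_rec k m : (m < n)%N ->
  m.+1%:R * (logp n ^+ k.+1)`_m.+1 + m%:R * (logp n ^+ k.+1)`_m =
  k.+1%:R * (logp n ^+ k)`_m.
Proof.
(* In degrees below n the truncation of the logarithm is invisible, and (1 + z) times the derivative
   of log (1 + z) is 1. *)
move=> lt_mn; have derivX : forall j, (j < n)%N ->
    ((1 + 'X) * (logp n)^`())`_j = (j == 0%N)%:R.
  move=> j lt_jn; rewrite mulrDl mul1r coefD coefXM !coef_deriv !coef_poly
    !ltnS lt_jn.
  have lc i : logc i.+1 *+ i.+1 = (-1) ^+ i.
    by rewrite /logc -[LHS]mulr_natr mulfVK ?natK_neq0.
  case: j lt_jn => [|j] lt_jn; rewrite lc /= ?addr0 ?expr0 //.
  by rewrite (ltnW lt_jn) lc exprS mulN1r addNr.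
transitivity (((1 + 'X) * (logp n ^+ k.+1)^`())`_m).
  rewrite mulrDl mul1r coefD coefXM !coef_deriv !mulr_natl.
  by case: (m) => [|m']; rewrite ?mulr0n.
rewrite deriv_exp /= mulrnAr mulrA coefMn mulr_natl coefM; congr (_ *+ _).
rewrite big_ord_recl derivX; last exact: leq_ltn_trans lt_mn.
rewrite mul1r subn0 big1 ?addr0 // => i _.
by rewrite derivX ?mul0r //; apply: leq_ltn_trans lt_mn; rewrite lift0.
Qed.

(** The coefficient of z^m in exp (x log (1 + z)) = (1 + z)^x. Both sides satisfy (m + 1) b_{m+1} =
    (x - m) b_m with b_0 = 1. *)
Lemma sum_stirling (x m : nat) : (m <= n)%N ->
  \sum_(k < n.+1) x%:R ^+ k * c k m = 'C(x, m)%:R.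
Proof.
elim: m => [|m IHm] le_mn.
  rewrite big_ord_recl big1 ?addr0 => [|k _].
    by rewrite /c fact0 invr1 !expr0 coef1 !mul1r bin0.
  by rewrite /c logp_coef_small // !mulr0.
apply: (mulfI (natK_neq0 (ltn0Sn m))); rewrite -natrM mul_bin_left.
have rec k : m.+1%:R * c k.+1 m.+1 = c k m - m%:R * c k.+1 m.
  rewrite /c factS natrM invfM.
  have -> : (logp n ^+ k)`_m = k.+1%:R^-1 * (k.+1%:R * (logp n ^+ k)`_m).
    by rewrite mulKf ?natK_neq0.
  rewrite -logp_coef_rec //; ring.
have cn : c n m = 0 by rewrite /c logp_coef_small ?mulr0.
have c0 l : c 0 l = (l == 0%N)%:R by rewrite /c fact0 invr1 mul1r expr0 coef1.
transitivity ((x%:R - m%:R) * 'C(x, m)%:R : K).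
  rewrite -IHm ?(ltnW le_mn) // mulrBl big_ord_recl c0 mulr0 add0r.
  rewrite [in X in _ = X - _]big_ord_recr /= cn mulr0 addr0.
  rewrite [in X in _ = _ - X]big_ord_recl c0 expr0 mul1r [m%:R * (_ + _)]mulrDr.
  have -> : m%:R * (m == 0%N)%:R = 0 :> K by case: (m) => *; rewrite ?mul0r
    ?mulr0.
  rewrite add0r !big_distrr /= -sumrB; apply: eq_bigr => k _.
  rewrite mulrCA -[bump 0 k]/(k.+1) rec exprS; ring.
have [le_mx|lt_xm] := leqP m x; first by rewrite -natrB // -natrM mulnC.
by rewrite bin_small // mulr0 muln0.
Qed.
End Stirling.

Lemma Theta_pos_rho n x :
  Theta K n x xpredT = \sum_(k < n.+1) x%:R ^+ k *: rho_num K n k.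
Proof.
rewrite Theta_pos_Xi; under [RHS]eq_bigr => k _ do rewrite rho_numE scaler_sumr.
rewrite exchange_big; apply: eq_bigr => q _ /=.
under [RHS]eq_bigr => k _ do rewrite scalerA.
by rewrite -scaler_suml sum_stirling // size_map size_bseq.
Qed.

End Rho.

(** * Orthogonal idempotents *)

Section Interpolation.
Variable K : fieldType.
Hypothesis charK0 : [pchar K] =i pred0.

(** [lam k] recovers the coefficient of degree k of a polynomial of degree at most n from its values
    at 0, ..., n; in characteristic 0 these points are distinct and the Vandermonde matrix is
    invertible. *)
Lemma interpolation n : exists lam : 'I_n.+1 -> 'I_n.+1 -> K,
  forall j k : 'I_n.+1, \sum_(x < n.+1) lam k x * x%:R ^+ j = (j == k)%:R.
Proof.
pose a : 'rV[K]_n.+1 := \row_x x%:R; pose A := Vandermonde n.+1 a.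
have unitA : A \in unitmx.
  rewrite unitmxE det_Vandermonde unitfE; apply/prodf_neq0 => i _.
  apply/prodf_neq0 => j lt_ij; rewrite !mxE -natrB ?(ltnW lt_ij) //.
  by rewrite (natK_neq0 charK0) ?subn_gt0.
exists (fun k x => invmx A x k) => j k.
have := congr1 (fun B : 'M_n.+1 => B j k) (mulmxV unitA); rewrite !mxE => <-.
by apply: eq_bigr => x _; rewrite !mxE mulrC.
Qed.

Lemma interpolate n (lam : 'I_n.+1 -> 'I_n.+1 -> K) (V : lmodType K) (v :
  'I_n.+1 -> V) k :
    (forall j k : 'I_n.+1, \sum_(x < n.+1) lam k x * x%:R ^+ j = (j == k)%:R) ->
  \sum_(x < n.+1) lam k x *: (\sum_(j < n.+1) x%:R ^+ j *: v j) = v k.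
Proof.
move=> lamP; under eq_bigr => x _ do rewrite scaler_sumr.
rewrite exchange_big (bigD1 k) //=.
have inner (j : 'I_n.+1) : \sum_(x < n.+1) lam k x *: (x%:R ^+ j *: v j) = (j
  == k)%:R *: v j.
  by rewrite -lamP scaler_suml; apply: eq_bigr => x _; rewrite scalerA.
rewrite inner eqxx scale1r big1 ?addr0 // => j /negbTE jk.
by rewrite inner jk scale0r.
Qed.

Lemma interpolate_eq n (V : lmodType K) (v w : 'I_n.+1 -> V) :
    (forall x : nat, \sum_(j < n.+1) x%:R ^+ j *: v j = \sum_(j < n.+1) x%:R ^+
      j *: w j) ->
  v =1 w.
Proof.
have [lam lamP] := interpolation n; move=> vw k.
rewrite -(interpolate v k lamP) -(interpolate w k lamP).
by apply: eq_bigr => x _; rewrite vw.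
Qed.

Section RhoTilde.
Variable n : nat.
Hypothesis n_gt0 : (0 < n)%N.
Local Notation T := (rho_tilde K n).

Lemma Theta_alt_rho x : Theta K n (x * 2) odd = \sum_(k < n.+1) x%:R ^+ k *: T
  k.
Proof.
rewrite -Theta_pos_mul Theta_pos_rho // -Xi_tilde_Theta // mulr_suml.
by apply: eq_bigr => k _; rewrite scalerAl.
Qed.

(** Extract the coefficient of x^k y^l from T(x) T(y) = T(2 x y) = sum_j (2 x y)^j T_j, where T_j
    stands for [T j]. *)
Lemma rho_tilde_mul (k l : 'I_n.+1) : T k * T l = (k == l)%:R *: (2 ^+ k *: T
  k).
Proof.
have [lam lamP] := interpolation n.
rewrite -{1}(interpolate (fun k : 'I_n.+1 => T k) k lamP).
rewrite -{1}(interpolate (fun k : 'I_n.+1 => T k) l lamP) mulr_suml.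
transitivity (\sum_(j < n.+1) (j == k)%:R *: ((j == l)%:R *: (2 ^+ j *: T j))).
  under [RHS]eq_bigr => j _ do rewrite -lamP scaler_suml.
  rewrite [RHS]exchange_big; apply: eq_bigr => x _.
  rewrite -Theta_alt_rho -scalerAl mulr_sumr.
  under [RHS]eq_bigr => j _ do rewrite -lamP scaler_suml scaler_sumr.
  rewrite [RHS]exchange_big scaler_sumr; apply: eq_bigr => y _ /=.
  rewrite -Theta_alt_rho -scalerAr Theta_alt_mul mulnA Theta_alt_rho
    !scaler_sumr.
  apply: eq_bigr => j _; rewrite !scalerA !natrM !exprMn; congr (_ *: _); ring.
rewrite (bigD1 k) //= eqxx scale1r big1 ?addr0 // => j /negbTE->.
by rewrite scale0r.
Qed.

Lemma rho_tilde_in_Etilde k : (k <= n)%N -> T k \in Etilde K n.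
Proof.
rewrite -ltnS => ltk; have [lam lamP] := interpolation n.
rewrite -[T k]/((fun k : 'I_n.+1 => T k) (Ordinal ltk)) -(interpolate _ _ lamP).
apply: memv_suml => x _; apply: memvZ; rewrite -Theta_alt_rho.
exact: Theta_alt_in_Etilde.
Qed.

Definition eidem k : KS K n := (2 ^+ k)^-1 *: T k.

Lemma pow2_neq0 k : 2%:R ^+ k != 0 :> K.
Proof. by rewrite expf_neq0 // (natK_neq0 charK0). Qed.

Lemma eidem_mul k l : (k <= n)%N -> (l <= n)%N ->
  eidem k * eidem l = (k == l)%:R *: eidem k.
Proof.
move=> le_kn le_ln; have := @rho_tilde_mul (@Ordinal n.+1 k le_kn) (@Ordinal
  n.+1 l le_ln).
rewrite /eidem -scalerAl -scalerAr -[_ == _]/(k == l) => ->; rewrite !scalerA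
  /=.
have [->|_] := eqVneq k l; last by rewrite /= mulr0n !(mul0r, mulr0, scale0r).
by rewrite /= mulr1n !mul1r -mulrA mulVf ?pow2_neq0 ?mulr1.
Qed.

(** Twice [Pi_num K n 0] is [Xi_tilde], the value at x = 1 of the family, which is the sum of all
    [T j]; only j = k acts on [eidem k], by 2^k. *)
Lemma Pi_num0_eidem k : (0 < k <= n)%N -> Pi_num K n 0 * eidem k = 2 ^+ k.-1 *:
  eidem k.
Proof.
move=> /andP[k_gt0 le_kn]; have := Theta_alt_rho 1.
rewrite mul1n -Xi_tilde_Theta // /Xi_tilde -Pi_num0 => eq2.
have two0 : 2%:R != 0 :> K by rewrite (natK_neq0 charK0).
apply: (scalerI two0); rewrite scalerAl eq2 mulr_suml.
rewrite (bigD1 (@Ordinal n.+1 k le_kn)) //= expr1n scale1r.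
rewrite big1 ?addr0 => [|j]; last first.
  rewrite -val_eqE /= => /negbTE jk; rewrite expr1n scale1r /eidem -scalerAr.
  have := rho_tilde_mul j (@Ordinal n.+1 k le_kn) => /= ->.
  by rewrite -val_eqE /= jk scale0r scaler0.
rewrite /eidem -scalerAr (rho_tilde_mul (@Ordinal n.+1 k le_kn) (@Ordinal n.+1
  k le_kn)).
rewrite eqxx scale1r scalerA mulVf ?pow2_neq0 // !scalerA -exprS prednK //.
by rewrite mulfV ?pow2_neq0.
Qed.

End RhoTilde.
End Interpolation.

(** * Partitions and power sums *)

Lemma geq_trans : transitive geq.
Proof. by move=> a b c /= ba cb; apply: leq_trans cb ba. Qed.

Lemma geq_anti : antisymmetric geq.
Proof. by move=> a b /= /andP[ba ab]; apply/eqP; rewrite eqn_leq ab ba. Qed.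

Lemma geq_total : total geq. Proof. by move=> a b; apply: leq_total. Qed.

Definition parts n : seq (seq nat) := [seq comp_word p | p : partition_of n].

Lemma mem_parts n w : (w \in parts n) = is_comp n w && sorted geq w.
Proof.
apply/imageP/andP => [[p _ ->]|[/comp_wordP[q ->] sq]].
  by split; [apply: (valP (val p)) | apply: (valP p)].
by exists (exist _ q sq).
Qed.

Lemma parts_uniq n : uniq (parts n).
Proof.
rewrite map_inj_uniq ?enum_uniq // => p q /comp_word_inj; exact: val_inj.
Qed.

Lemma sum_parts (V : nmodType) n (P : pred (seq nat)) (F : seq nat -> V) :
  \sum_(p : partition_of n | P p) F p = \sum_(w <- parts n | P w) F w.
Proof. by rewrite big_image_cond; apply: eq_bigl => q. Qed.

Lemma is_comp_perm n v w : perm_eq v w -> is_comp n v = is_comp n w.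
Proof.
by move=> vw; rewrite /is_comp (perm_mem vw); congr ((_ == _) && _); apply:
  perm_sumn.
Qed.

Lemma qfact_perm v w : perm_eq v w -> qfact v = qfact w.
Proof.
move=> vw; rewrite /qfact (perm_big _ (perm_undup (perm_mem vw))).
by apply: eq_bigr => i _; rewrite (seq.permP vw).
Qed.

Lemma qfact_cons i v : qfact (i :: v) = (i * (count_mem i v).+1 * qfact v)%N.
Proof.
rewrite /qfact [undup _]/=; case: ifP => iv.
  rewrite !(bigD1_seq i) ?undup_uniq ?mem_undup //= eqxx add1n factS expnS.
  rewrite [X in (_ * X = _)%N](eq_bigr (fun j => (count_mem j v)`! * j ^
    count_mem j v)%N).
    by ring.
  by move=> j; rewrite eq_sym => /negbTE->.
have civ : count_mem i v = 0%N by apply/count_memPn; rewrite iv.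
rewrite big_cons /= eqxx civ addn0 expn1 mul1n muln1; congr (_ * _)%N.
apply: eq_big_seq => j; rewrite mem_undup => jv.
by case: eqP => // ij; rewrite ij jv in iv.
Qed.

Lemma qfact_gt0 w : 0%N \notin w -> (0 < qfact w)%N.
Proof.
elim: w => [|i w IHw]; first by rewrite /qfact big_nil.
rewrite inE negb_or => /andP[i0 /IHw w0]; rewrite qfact_cons !muln_gt0 w0.
by rewrite lt0n eq_sym i0.
Qed.

Lemma sumn_undup w : sumn w = (\sum_(i <- undup w) i * count_mem i w)%N.
Proof.
elim: w => [|i w IHw]; first by rewrite big_nil.
rewrite [sumn _]/= IHw [undup (i :: w)]/=; case: ifP => iw.
  have iu : i \in undup w by rewrite mem_undup.
  rewrite (bigD1_seq i iu (undup_uniq w)) [RHS](bigD1_seq i iu (undup_uniq w))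
    /=.
  rewrite eqxx mulnDr muln1 addnA; congr (_ + _)%N; apply: eq_bigr => j; by
    rewrite eq_sym => /negbTE->.
have ciw : count_mem i w = 0%N by apply/count_memPn; rewrite iw.
rewrite big_cons /= eqxx ciw muln1; congr (_ + _)%N.
apply: eq_big_seq => j; rewrite mem_undup => jw.
by case: eqP => // ij; rewrite ij jw in iw.
Qed.

Lemma sorted_geq_perm v w : sorted geq v -> sorted geq w -> perm_eq v w -> v =
  w.
Proof. exact: (sorted_eq geq_trans geq_anti). Qed.

(** Partitions with a distinguished part size correspond to pairs of a part and a partition of the
    rest; the inverse inserts the part and sorts. *)
Lemma parts_pairs n :
  perm_eq [seq (i, rem i w) | w <- parts n, i <- undup w]
          [seq (i, v) | i <- iota 1 n, v <- parts (n - i)].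
Proof.
have remP i w : i \in w -> sorted geq w -> perm_eq w (i :: rem i w) /\ sorted
  geq (rem i w).
  by move=> iw sw; split; [apply: perm_to_rem | apply: subseq_sorted sw;
    [apply: geq_trans | apply: rem_subseq]].
apply: uniq_perm.
- apply: allpairs_uniq_dep => [|w _|]; [exact: parts_uniq|exact: undup_uniq|].
  move=> [w i] [w' i'] /allpairsPdep[w1 [i1 [w1p + [-> ->]]]] /allpairsPdep[w2
    [i2 [w2p + [-> ->]]]] /=.
  rewrite !mem_undup => iw1 iw2 [eq_i eq_rem].
  move: w1p w2p; rewrite !mem_parts => /andP[_ s1] /andP[_ s2].
  have [p1 _] := remP _ _ iw1 s1; have [p2 _] := remP _ _ iw2 s2.
  rewrite (sorted_geq_perm s1 s2) ?eq_i //.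
  by rewrite (permPl p1) eq_rem eq_i perm_sym.
- by apply: allpairs_uniq_dep => [|i _|[? ?] [? ?] _ _ [-> ->]]; rewrite
  ?iota_uniq ?parts_uniq.
case=> i v; apply/allpairsPdep/allpairsPdep => [[w [j [+ + [-> ->]]]]|[j [u [+
  + [-> ->]]]]].
  rewrite mem_parts mem_undup => /andP[cw sw] jw; have [pw sr] := remP _ _ jw
    sw.
  move: cw; rewrite (is_comp_perm _ pw) is_comp_cons => /andP[jn cr].
  by exists j, (rem j w); rewrite mem_iota add1n ltnS jn mem_parts cr sr.
rewrite mem_iota add1n ltnS mem_parts => jn /andP[cu su].
pose w := sort geq (j :: u); have pw : perm_eq w (j :: u) by rewrite perm_sort.
have jw : j \in w by rewrite (perm_mem pw) mem_head.
have sw : sorted geq w by apply/sort_sorted/geq_total.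
have [pr sr] := remP _ _ jw sw.
exists w, j; rewrite mem_parts (is_comp_perm _ pw) is_comp_cons jn cu sw
  mem_undup jw.
split=> //; congr (_, _); apply: sorted_geq_perm => //.
by rewrite -(perm_cons j) -(permPr pr) perm_sym.
Qed.

Section PowerSums.
Variable K : fieldType.
Hypothesis charK0 : [pchar K] =i pred0.
Implicit Types z a b : nat -> {poly K}.

(* The coefficients a_n of the power series exp (\sum_i z_i t^i / i), through  *)
(* its logarithmic derivative.                                                 *)
Definition is_exp z a :=
  a 0%N = 1 /\ forall n, n.+1%:R *: a n.+1 = \sum_(i < n.+1) z i.+1 * a (n -
    i)%N.

Definition cauchy a b n := \sum_(i < n.+1) a i * b (n - i)%N.

Lemma is_exp_uniq z z' a b : is_exp z a -> is_exp z' b -> z =1 z' -> a =1 b.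
Proof.
move=> [a0 aS] [b0 bS] eq_z n; have [m] := ubnP n; elim: m n => // m IHm [|n]
  ltnm.
  by rewrite a0 b0.
apply: (scalerI (natK_neq0 charK0 (ltn0Sn n))); rewrite aS bS.
by apply: eq_bigr => i _; rewrite eq_z IHm //; lia.
Qed.

(** The exponential of a sum is the product of the exponentials. The proof is the Leibniz rule for A
    B with A' = Z A and B' = Z' B, on polynomials truncated beyond the degrees compared. *)
Lemma is_exp_cauchy z z' a b :
  is_exp z a -> is_exp z' b -> is_exp (fun i => z i + z' i) (cauchy a b).
Proof.
move=> [a0 aS] [b0 bS]; split=> [|n]; first by rewrite /cauchy big_ord1 a0 b0
  mul1r.
pose A := \poly_(i < n.+2) a i; pose B := \poly_(i < n.+2) b i.
pose Z := \poly_(i < n.+1) z i.+1; pose Z' := \poly_(i < n.+1) z' i.+1.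
have derivE (c : nat -> {poly K}) y m : is_exp y c -> (m <= n)%N ->
    (\poly_(i < n.+2) c i)^`()`_m = ((\poly_(i < n.+1) y i.+1) * \poly_(i <
      n.+2) c i)`_m.
  move=> [_ cS] le_mn; rewrite coef_deriv coef_poly !ltnS le_mn -scaler_nat cS
    coefM.
  apply: eq_bigr => i _; rewrite !coef_poly.
  by have := ltn_ord i; rewrite ltnS => le_im; rewrite ifT ?ifT //; lia.
have AB m : (m <= n.+1)%N -> (A * B)`_m = cauchy a b m.
  move=> le_mn; rewrite coefM; apply: eq_bigr => i _; rewrite !coef_poly.
  by have := ltn_ord i; rewrite ltnS => le_im; rewrite ifT ?ifT //; lia.
rewrite -AB // scaler_nat -coef_deriv derivM coefD.
transitivity (((Z + Z') * (A * B))`_n); last first.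
  rewrite coefM; apply: eq_bigr => i _; rewrite AB; last by lia.
  by rewrite coefD !coef_poly ltn_ord.
rewrite mulrDl coefD; congr (_ + _).
  rewrite mulrA !coefM; apply: eq_bigr => i _; congr (_ * _).
  by apply: derivE => //; rewrite -ltnS.
rewrite mulrCA !coefM; apply: eq_bigr => i _; congr (_ * _).
by apply: derivE => //; lia.
Qed.

Definition alt z i : {poly K} := (-1) ^+ i * z i.

Lemma is_exp_alt z a : is_exp z a -> is_exp (alt z) (alt a).
Proof.
move=> [a0 aS]; split=> [|n]; first by rewrite /alt mul1r.
rewrite /alt scalerAr aS big_distrr; apply: eq_bigr => i _ /=.
have le_in : (i <= n)%N by rewrite -ltnS.
rewrite mulrACA -exprD; congr (_ ^+ _ * _); lia.
Qed.

Lemma is_exp0 : is_exp (fun=> 0) (fun n => (n == 0%N)%:R).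
Proof.
by split=> // n; rewrite scaler0 big1 // => i _; rewrite mul0r.
Qed.

Definition psum_exp z n : {poly K} :=
  \sum_(p : partition_of n) (qfact p)%:R^-1 *: \prod_(i <- comp_word p) z i.

(** This is the recursion n h_n = sum_i p_i h_{n-i} for complete symmetric functions in terms of
    power sums. The factor n is distributed as the sum of i m_i over the distinct parts i, with m_i
    the multiplicity; removing one part i from a partition divides its [qfact] by i m_i. *)
Lemma psum_exp_is_exp z : is_exp z (psum_exp z).
Proof.
have psumE n : psum_exp z n = \sum_(w <- parts n) (qfact w)%:R^-1 *: \prod_(i
  <- w) z i.
    by rewrite -(@sum_parts _ _ xpredT (fun w => (qfact w)%:R^-1 *: \prod_(i <-
      w) z i)).
split=> [|n].
  have eq0 : perm_eq (parts 0) [:: [::]].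
    apply: uniq_perm; rewrite ?parts_uniq // => -[|a q]; rewrite mem_parts //
      is_comp_cons.
    by case: a.
  by rewrite psumE (perm_big _ eq0) big_seq1 big_nil /qfact big_nil invr1
    scale1r.
transitivity (\sum_(1 <= i < n.+2) z i * psum_exp z (n.+1 - i)); last first.
  by rewrite big_add1 /= big_mkord.
transitivity (\sum_(p <- [seq (i, v) | i <- iota 1 n.+1, v <- parts (n.+1 - i)])
   z p.1 * ((qfact p.2)%:R^-1 *: \prod_(i <- p.2) z i)); last first.
  rewrite big_allpairs_dep; apply: eq_bigr => i _.
  by rewrite psumE big_distrr.
rewrite -(perm_big _ (parts_pairs n.+1)) big_allpairs_dep psumE scaler_sumr.
apply: eq_big_seq => w; rewrite mem_parts => /andP[/andP[/eqP sw w0] _].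
rewrite -{1}sw sumn_undup natr_sum scaler_suml; apply: eq_big_seq => i.
rewrite mem_undup => iw /=; have pw := perm_to_rem iw.
rewrite (perm_big _ pw) big_cons (qfact_perm pw) qfact_cons -scalerAr scalerA.
rewrite (seq.permP pw) /= eqxx add1n; congr (_ *: _).
have i0 : (0 < i)%N by rewrite lt0n; apply: contraNneq w0 => <-.
rewrite [X in _ / X]natrM invfM mulrA mulfV ?mul1r // (natK_eq0 charK0) //
  -lt0n muln_gt0 i0 //.
Qed.

End PowerSums.

(** * Linear maps that are multiplicative on the elements Xi *)

Section SignedBlocks.
Variable K : fieldType.
Local Notation mono := (mono K).
Implicit Types (w v : seq nat) (u : seq (bool * nat)) (F G : seq nat -> K).

Definition signed_dec w : K := (-1) ^+ size w * mono false w.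

(** Decreasing words with sign are inverse to increasing words under convolution, the analogue for
    words of sum_i (-1)^i e_i h_{a-i} = 0. The cuts with nonempty decreasing factor add up to minus
    the term of the empty one. *)
Lemma conv_signed_dec w : uniq w -> conv signed_dec (mono true) w = (w ==
  [::])%:R.
Proof.
have rec v : forall x, uniq (x :: v) ->
    conv (fun t => signed_dec (x :: t)) (mono true) v = - mono true (x :: v).
  elim: v => [|y v IHv] x uxv.
    by rewrite conv_nil /signed_dec !mono1 mono0 /= expr1 !mulr1.
  have /andP[xv uyv] : (x \notin y :: v) && uniq (y :: v) := uxv.
  rewrite conv_cons mono_cons2 {1}/signed_dec mono1 expr1 mulr1 mulN1r.
  rewrite (@eq_conv _ _ (fun t => - (y < x)%N%:R * signed_dec (y :: t)) _ (mono
    true)) //.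
    rewrite conv_scalel IHv // mulrNN /=.
    have : x != y by move: xv; rewrite inE; case: eqP.
    by case: (ltngtP x y) => //= _ _; ring.
  by move=> v' _; rewrite /signed_dec mono_cons2 /= exprS; ring.
case: w => [|x w] uw; first by rewrite conv_nil /signed_dec !mono0 !mulr1.
by rewrite conv_cons rec // /signed_dec mono0 !mul1r subrr.
Qed.

Definition prefixed u F := foldr (fun p G => conv (blk K p.1 p.2) G) F u.

Lemma sum_blk_signed a v : uniq v -> (0 < a)%N ->
  \sum_(i < a.+1) (-1) ^+ i * conv (blk K false i) (blk K true (a - i)%N) v = 0.
Proof.
move=> uv a0; have [size_v|size_v] := eqVneq (size v) a; last first.
  apply: big1 => i _; rewrite conv_blk /blk size_drop; case: ifP => iv; rewrite
    ?mulr0 //.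
  have le_ia : (i <= a)%N by rewrite -ltnS.
  have /negbTE-> : (size v - i != a - i)%N.
    by apply: contra size_v => /eqP eq_i; rewrite -(subnKC iv) eq_i subnKC.
  by rewrite mul0r !mulr0.
transitivity (conv signed_dec (mono true) v); last first.
  by rewrite conv_signed_dec // -size_eq0 size_v eqn0Ngt a0.
rewrite [RHS]/conv size_v; apply: eq_bigr => i _.
have le_ia : (i <= a)%N by rewrite -ltnS.
by rewrite conv_blk /blk /signed_dec size_drop size_v le_ia eqxx mul1r
  size_takel ?size_v // mulrA.
Qed.

(** Fixed block lengths leave a suffix of a single possible length, so [F] and [G] matter only
    there. *)
Lemma eq_prefixed u F G w : uniq w ->
  (forall v, uniq v -> size v + sumn (map snd u) = size w -> F v = G v)%N ->
  prefixed u F w = prefixed u G w.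
Proof.
elim: u w => [|[b a] u IHu] w uw eqFG; first by apply: eqFG; rewrite ?addn0.
rewrite /= !conv_blk; case: ifP => // le_aw; congr (_ * _).
apply: IHu => [|v uv]; rewrite ?drop_uniq // size_drop => size_v.
by apply: eqFG; rewrite //= addnCA size_v subnKC.
Qed.

Lemma prefixed_sum (I : Type) (r : seq I) (P : pred I) (a : I -> K) u
    (F : I -> seq nat -> K) w :
  prefixed u (fun v => \sum_(i <- r | P i) a i * F i v) w =
  \sum_(i <- r | P i) a i * prefixed u (F i) w.
Proof.
elim: u w => //= p u IHu w.
rewrite (eq_convr _ IHu) conv_sumr; apply: eq_bigr => i _; exact: conv_scaler.
Qed.

Lemma prefixed_cat u u' F w : prefixed (u ++ u') F w = prefixed u (prefixed u'
  F) w.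
Proof. by rewrite /prefixed foldr_cat. Qed.

Lemma prefixed_signed u u' a w : uniq w -> (0 < a)%N ->
  \sum_(i < a.+1) (-1) ^+ i * blocks K (u ++ [:: (false, val i), (true, a -
    i)%N & u']) w = 0.
Proof.
move=> uw a0.
under eq_bigr => i _ do rewrite -[blocks K _]/(prefixed _ (unitw K))
  prefixed_cat.
rewrite -prefixed_sum (@eq_prefixed _ _ (fun=> 0)) //.
  elim: u w uw => //= p u IHu w uw; rewrite /conv big1 // => i _.
  by rewrite IHu ?mulr0 ?drop_uniq.
move=> v uv _ /=; under eq_bigr => i _ do rewrite convA -conv_scalel.
rewrite -conv_suml /conv big1 // => i _.
by rewrite sum_blk_signed ?mul0r // take_uniq.
Qed.

Lemma blk0 b w : blk K b 0 w = unitw K w.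
Proof.
by rewrite /blk /unitw size_eq0; case: w => [|x w]; rewrite ?mono0 ?mulr1 //
  mul0r.
Qed.

Lemma prefixed_skip u b u' F w : prefixed (u ++ (b, 0%N) :: u') F w = prefixed
  (u ++ u') F w.
Proof.
rewrite !prefixed_cat; elim: u w => [|p u IHu] w /=; last exact: eq_convr.
by rewrite (@eq_conv _ _ (unitw K) _ (prefixed u' F)) ?conv1w // => v _;
  rewrite blk0.
Qed.

End SignedBlocks.

Section Evaluation.
Variables (K : fieldType) (n : nat).
Hypothesis charK0 : [pchar K] =i pred0.
Hypothesis n_gt0 : (0 < n)%N.
Variables (L : {linear KS K n -> {poly K}}) (y h : nat -> {poly K}).
Hypothesis h_exp : is_exp y h.
Hypothesis L_Xi : forall q, is_comp n q -> L (Xi K n q) = \prod_(i <- q) h i.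
Implicit Types (w v : seq nat) (u : seq (bool * nat)) (F G : seq nat -> K).

Definition lift_word F : KS K n := [ffun s => F (word s) : K^o].

Lemma eq_lift F G : (forall w, uniq w -> size w = n -> F w = G w) ->
  lift_word F = lift_word G.
Proof. by move=> FG; apply/ffunP=> s; rewrite !ffunE FG ?word_uniq ?size_word.
  Qed.

Lemma lift_sum (I : Type) (r : seq I) (a : I -> K) (F : I -> seq nat -> K) :
  lift_word (fun w => \sum_(i <- r) a i * F i w) = \sum_(i <- r) a i *:
    lift_word (F i).
Proof.
apply/ffunP=> s; rewrite ffunE sum_ffunE; apply: eq_bigr => i _.
by rewrite galg_scaleE ffunE.
Qed.

(** If h plays the role of the complete symmetric functions, these are the elementary ones; they
    turn out to be the values of [L] on decreasing blocks. *)
Definition neg_exp := psum_exp (fun i => - alt y i).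
Definition ser (b : bool) := if b then h else neg_exp.

Lemma neg_exp_is_exp : is_exp (fun i => - alt y i) neg_exp.
Proof. exact: psum_exp_is_exp. Qed.

Lemma neg_exp_h a : (0 < a)%N ->
  \sum_(i < a.+1) (-1) ^+ i * (neg_exp i * h (a - i)%N) = 0.
Proof.
move=> a_gt0; have altexp := is_exp_cauchy (is_exp_alt neg_exp_is_exp) h_exp.
have z0 : (fun i => alt (fun i => - alt y i) i + y i) =1 (fun=> 0).
  by move=> i; rewrite /alt mulrN mulrA -exprMn mulrNN mul1r expr1n mul1r addNr.
have := is_exp_uniq charK0 altexp (is_exp0 K) z0 a.
rewrite eqn0Ngt a_gt0 mulr0n /cauchy => sum0; rewrite -[RHS]sum0.
by apply: eq_bigr => i _; rewrite mulrA.
Qed.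

Definition serprod u := \prod_(p <- u) ser p.1 p.2.

Lemma ser0 b : ser b 0 = 1.
Proof. by case: b; [case: h_exp | case: neg_exp_is_exp]. Qed.

Lemma serprod_cat u u' : serprod (u ++ u') = serprod u * serprod u'.
Proof. exact: big_cat. Qed.

Definition negs u := sumn [seq p.2 | p <- u & ~~ p.1].

(** Multiplicativity on increasing blocks is the hypothesis [L_Xi]. A decreasing block is traded, by
    the relation of [prefixed_signed], for terms with shorter decreasing blocks, while the values
    satisfy the same relation by [neg_exp_h]; the induction is on the total length of the decreasing
    blocks. *)
Lemma L_blocks u : sumn (map snd u) = n -> L (lift_word (blocks K u)) = serprod
  u.
Proof.
have [m] := ubnP (negs u); elim: m u => // m IHm u ltm sum_u.
have [/hasP[[b a] a_in /= /andP[nb a_gt0]]|noneg] :=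
    boolP (has (fun p => ~~ p.1 && (0 < p.2)%N) u); last first.
  pose q := [seq i <- map snd u | 0 < i]%N.
  have cq : is_comp n q.
    rewrite /is_comp mem_filter /= andbT -sum_u; apply/eqP.
    by rewrite /q; elim: (u) => //= -[b' [|i]] u' /= ->.
  transitivity (L (Xi K n q)).
    congr (L _); apply/ffunP=> s; rewrite ffunE Xi_blocks // /q.
    elim: u noneg {IHm ltm sum_u q cq} (word s) => //= -[b i] u IHu; rewrite
      negb_or => /andP[bi nu] w.
    case: i bi => [|i] /= bi.
      by rewrite (@eq_conv _ _ (unitw K) _ (blocks K u)) ?conv1w ?IHu // => v
        _; rewrite blk0.
    by move: bi; rewrite andbT negbK => ->; apply: eq_convr => v; rewrite IHu.
  rewrite L_Xi // /q /serprod.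
  elim: u noneg {IHm ltm sum_u q cq} => [|[b i] u IHu]; first by rewrite
    !big_nil.
  rewrite /= negb_or big_cons => /andP[bi nu]; case: i bi => [|i] /= bi.
    by rewrite ser0 mul1r IHu.
  by move: bi; rewrite andbT negbK => ->; rewrite big_cons IHu.
case: b nb a_in => // _ /splitPr def_u.
case: def_u ltm sum_u => u1 u2 ltm sum_u.
(* For i < a the word [t i] has smaller [negs]; [t a] is the given word with an additional empty
   block. *)
pose t i := u1 ++ [:: (false, i), (true, a - i)%N & u2].
have rel : \sum_(i < a.+1) (-1) ^+ i *: (L (lift_word (blocks K (t i))) -
  serprod (t i)) = 0.
  under eq_bigr => i _ do rewrite scalerBr.
  rewrite sumrB [X in _ - X](_ : _ = 0) ?subr0.
    rewrite -[RHS](linear0 L) -(_ : \sum_(i < a.+1) (-1) ^+ i *: lift_word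
      (blocks K (t i)) = 0).
      by rewrite linear_sum; apply: eq_bigr => i _; rewrite linearZ.
    rewrite -lift_sum; apply/ffunP=> s; rewrite !ffunE.
    by rewrite prefixed_signed ?word_uniq.
  transitivity (serprod u1 * serprod u2 * (\sum_(i < a.+1) (-1) ^+ i * (neg_exp
    i * h (a - i)%N))).
    rewrite big_distrr; apply: eq_bigr => i _.
    rewrite /t serprod_cat {2}/serprod !big_cons -/(serprod u2) /= -mul_polyC
      rmorphXn rmorphN1.
    ring.
  by rewrite neg_exp_h // mulr0.
move: rel; rewrite big_ord_recr big1 ?add0r => [|i _] /=; last first.
  rewrite IHm ?subrr ?scaler0 //.
    move: ltm; rewrite /negs /t !filter_cat !map_cat !sumn_cat /=.
    by have := ltn_ord i; lia.
  move: sum_u; rewrite /t !map_cat !sumn_cat /=.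
  by have := ltn_ord i; lia.
rewrite add0r => /eqP; rewrite scaler_eq0 signr_eq0 /= subr_eq0 => /eqP.
have -> : serprod (t a) = serprod (u1 ++ (false, a) :: u2).
  by rewrite /t subnn !serprod_cat /serprod !big_cons ser0 mul1r.
move=> <-; congr (L _); apply: eq_lift => w _ _.
have := prefixed_skip (rcons u1 (false, a)) true u2 (unitw K) w.
by rewrite !cat_rcons /t subnn => /esym.
Qed.

Fixpoint serA (A : seq bool) : nat -> {poly K} :=
  if A is b :: A' then cauchy (ser b) (serA A') else fun m => (m == 0%N)%:R.

(** Summing over the length of each factor reduces factors of arbitrary length to blocks, and turns
    the product of values into a Cauchy product of series. *)
Lemma L_splits A u : (sumn (map snd u) <= n)%N ->
  L (lift_word (prefixed u (splits K A))) = serprod u * serA A (n - sumn (map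
    snd u)).
Proof.
elim: A u => [|b A IHA] u le_un /=.
  rewrite subn_eq0 -[prefixed _ _]/(blocks K u).
  move: le_un; rewrite leq_eqVlt => /orP[/eqP eq_un|lt_un].
    by rewrite L_blocks // eq_un leqnn mulr1.
  rewrite leqNgt lt_un mulr0 -[RHS](linear0 L); congr (L _).
  apply/ffunP=> s; rewrite ffunE ffunE -[blocks K u]/(prefixed u (unitw K)).
  rewrite (@eq_prefixed _ _ _ (fun=> 0)) ?word_uniq //; last first.
    move=> v _; rewrite size_word /unitw -size_eq0 => size_v.
    by rewrite (_ : (size v == 0)%N = false) //; lia.
  by elim: u (word s) {lt_un} => //= p u IHu w; rewrite /conv big1 // => i _;
    rewrite IHu mulr0.
set k := (n - sumn _)%N.
transitivity (L (\sum_(i < k.+1) 1 *: lift_word (prefixed (rcons u (b, val i))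
  (splits K A)))).
  rewrite -lift_sum; congr (L _); apply: eq_lift => w uw size_w.
  under [RHS]eq_bigr => i _ do rewrite -cats1 prefixed_cat.
  rewrite -prefixed_sum; apply: eq_prefixed => // v uv size_v.
  have size_vk : size v = k by rewrite /k -size_w -size_v addnK.
  rewrite /conv size_vk; apply: eq_bigr => i _ /=.
  have le_ik : (i <= k)%N by rewrite -ltnS.
  by rewrite conv_blk size_vk le_ik mul1r.
rewrite linear_sum /cauchy big_distrr; apply: eq_bigr => i _ /=.
have le_ik : (i <= k)%N by rewrite -ltnS.
rewrite scale1r IHA map_rcons sumn_rcons /=; last by rewrite -leq_subRL.
by rewrite subnDA -cats1 serprod_cat {2}/serprod big_seq1 mulrA.
Qed.

(** Each of the x pairs of a negative and a positive letter multiplies the series by the exponential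
    attached to y_i - (-1)^i y_i. *)
Lemma serA_alt x k : ~~ odd k -> is_exp (fun i => x%:R * (y i - alt y i))
  (serA [seq odd j | j <- iota k (x * 2)]).
Proof.
elim: x k => [|x IHx] k even_k.
  by have [a0 aS] := is_exp0 K; split=> // m; rewrite aS; apply: eq_bigr => i
    _; rewrite !mul0r.
rewrite mulSn /= (negbTE even_k) /=.
have := is_exp_cauchy neg_exp_is_exp (is_exp_cauchy h_exp (IHx k.+2 _)).
rewrite /= negbK => /(_ even_k) [a0 aS]; split=> // m; rewrite aS.
by apply: eq_bigr => i _; rewrite -[x.+1]addn1 natrD; congr (_ * _); ring.
Qed.

Lemma L_Theta_alt x : L (Theta K n (x * 2) odd) =
  psum_exp (fun i => x%:R * (y i - alt y i)) n.
Proof.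
have -> : Theta K n (x * 2) odd =
    lift_word (prefixed [::] (splits K [seq odd j | j <- iota 0 (x * 2)])).
  by apply/ffunP=> s; rewrite ThetaE ffunE.
rewrite L_splits // /serprod big_nil mul1r subn0.
by apply: (is_exp_uniq charK0 (serA_alt x (isT : ~~ odd 0)) (psum_exp_is_exp
  charK0 _)).
Qed.

(** In [L_Theta_alt] an even part contributes 0 and an odd part i contributes 2 x y_i. Hence a
    partition with k parts, all odd, carries the factor (2x)^k, and comparing powers of x isolates
    these partitions. *)
Lemma L_eidem k : (k <= n)%N -> L (eidem K n k) =
  \sum_(p : partition_of n | all odd p && (size p == k)) (qfact p)%:R^-1 *:
    \prod_(i <- comp_word p) y i.
Proof.
rewrite -ltnS => lt_kn.
pose v (j : 'I_n.+1) := L (rho_tilde K n j).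
pose w (j : 'I_n.+1) : {poly K} := 2 ^+ j *: \sum_(p : partition_of n | all odd
  p && (size p == j))
  (qfact p)%:R^-1 *: \prod_(i <- comp_word p) y i.
suff vw : v =1 w.
  have := vw (Ordinal lt_kn); rewrite /v /w /= /eidem linearZ /= => ->.
  by rewrite scalerA mulVf ?scale1r // pow2_neq0.
apply: (interpolate_eq charK0) => x.
transitivity (L (Theta K n (x * 2) odd)).
  by rewrite Theta_alt_rho // linear_sum; apply: eq_bigr => j _; rewrite
    linearZ.
rewrite L_Theta_alt /psum_exp.
under [RHS]eq_bigr => j _ do rewrite scalerA -exprMn scaler_sumr.
rewrite [RHS](exchange_big_dep (fun p : partition_of n => all odd p)) /=; last
  by move=> j p _ /andP[].
rewrite [LHS](bigID (fun p : partition_of n => all odd p)) /= [X in _ + X]big1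
  ?addr0; last first.
  move=> p /allPn[i ip even_i]; rewrite (big_rem i ip) /= /alt -signr_odd
    (negbTE even_i).
  by rewrite mul1r subrr mulr0 mul0r scaler0.
apply: eq_bigr => p odd_p.
have size_p : (size p < n.+1)%N by rewrite size_map ltnS size_bseq.
rewrite (big_pred1 (Ordinal size_p)) => [|j]; last by rewrite odd_p /= -val_eqE
  eq_sym.
rewrite /= scalerA mulrC -scalerA; congr (_ *: _).
have : all odd p := odd_p.
elim: (comp_word p) => [|i q IHq]; first by rewrite !big_nil expr0 scale1r.
move=> /= /andP[odd_i odd_q]; rewrite !big_cons IHq // /alt -signr_odd odd_i.
rewrite exprS -scalerAr -mul_polyC -[RHS]mul_polyC !rmorphM !rmorphXn /=
  !rmorphM !polyC_natr; ring.
Qed.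

End Evaluation.

(** * Class functions *)

Lemma exists_linear (K : fieldType) (V W : lmodType K) (f : V -> W) :
  linear f -> exists g : {linear V -> W}, g =1 f.
Proof.
move=> lin_f; pose fl := GRing.isLinear.Build K V W *:%R f lin_f.
pose g : {linear V -> W} := HB.pack f fl.
by exists g.
Qed.

Lemma card_porbits_sum n (s : {perm 'I_n}) : sumn (cycle_type s) = n.
Proof.
rewrite sumnE big_image /= -[RHS]card_ord -sum1_card.
rewrite (partition_big_imset (porbit s)); apply: eq_bigr => X /imsetP[x _ ->].
rewrite sum1dep_card; apply: eq_card => y.
by rewrite !inE eq_porbit_mem.
Qed.

Lemma is_comp_cycle_type n (s : {perm 'I_n}) : is_comp n (cycle_type s).
Proof.
rewrite /is_comp card_porbits_sum eqxx; apply/negP => /imageP[X /imsetP[x _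
  ->]].
by move/eqP; rewrite eq_sym (negbTE (card_porbit_neq0 s x)).
Qed.

(** Cut the points into consecutive intervals whose lengths are the entries of [w] and rotate each
    interval by one step; the intervals are the orbits, since the k-th power rotates by k steps. *)
Lemma exists_cycle_type n w : is_comp n w ->
  exists s : {perm 'I_n}, perm_eq (cycle_type s) w.
Proof.
case/andP=> /eqP sw w0.
pose blk i := reshape_index w i; pose off i := reshape_offset w i.
pose len i := nth 0%N w (blk i).
have blkP (i : 'I_n) : (blk i < size w)%N by apply: reshape_indexP; rewrite sw.
have offP (i : 'I_n) : (off i < len i)%N by apply: reshape_offsetP; rewrite sw.
have len_gt0 (i : 'I_n) : (0 < len i)%N by apply: leq_ltn_trans (offP i).
have nextP (i : 'I_n) k : (flatten_index w (blk i) ((off i + k) %% len i) <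
  n)%N.
  by rewrite -[ltnRHS]sw flatten_indexP // ltn_mod.
pose next k (i : 'I_n) := Ordinal (nextP i k).
have blk_next k i : blk (next k i) = blk i by apply: flatten_indexKl; rewrite
  ltn_mod.
have off_next k i : off (next k i) = ((off i + k) %% len i)%N.
  by apply: flatten_indexKr; rewrite ltn_mod.
have ord_eq (i j : 'I_n) : blk i = blk j -> off i = off j -> i = j.
  move=> eq_b eq_o; apply/val_inj.
  by rewrite /= -(reshape_indexK w i) -(reshape_indexK w j) -/(blk i) -/(off i)
    eq_b eq_o.
have next_inj : injective (next 1%N).
  move=> i j eq_ij; have eq_b : blk i = blk j by rewrite -(blk_next 1%N) eq_ij
    blk_next.
  have eq_len : len i = len j by rewrite /len eq_b.
  apply: ord_eq => //; have := off_next 1%N i; rewrite eq_ij off_next -eq_len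
    => /eqP.
  have offj : (off j < len i)%N by rewrite eq_len.
  by rewrite eqn_modDr !modn_small // => /eqP->.
pose s := perm next_inj.
have sX k i : (s ^+ k)%g i = next k i.
  elim: k i => [|k IHk] i.
    rewrite expg0 perm1; apply: ord_eq; rewrite ?blk_next ?off_next // addn0.
    by rewrite modn_small.
  rewrite expgSr permM IHk permE; apply: ord_eq; rewrite ?blk_next // !off_next.
  by rewrite /len blk_next modnDml -addnA addn1.
pose fib r := [set i : 'I_n | blk i == r].
have porbit_fib i : porbit s i = fib (blk i).
  apply/setP=> j; rewrite inE; apply/porbitP/eqP => [[k ->]|eq_b]; first by
    rewrite sX blk_next.
  exists (off j + (len i - off i))%N; rewrite sX; apply: ord_eq; rewrite
    ?blk_next // off_next.
  rewrite addnCA subnKC ?(ltnW (offP i)) // modnDr modn_small //.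
  by have := offP j; rewrite /len eq_b.
have fib_gt0 r : (r < size w)%N -> (0 < nth 0 w r)%N.
  by move=> ltr; rewrite lt0n; apply: contraNneq w0 => <-; apply: mem_nth.
have cell r c : (c < nth 0%N w r)%N -> (flatten_index w r c < n)%N.
  by move=> ltc; rewrite -sw flatten_indexP.
have fib_ex r : (r < size w)%N -> exists i : 'I_n, blk i = r.
  by move=> ltr; exists (Ordinal (cell _ _ (fib_gt0 r ltr))); apply:
    flatten_indexKl (fib_gt0 r ltr).
have card_fib r : #|fib r| = nth 0%N w r.
  pose g (c : 'I_(nth 0%N w r)) := Ordinal (cell r c (ltn_ord c)).
  have g_inj : injective g.
    move=> c d /(congr1 (fun i : 'I_n => off i)); rewrite /off /=
      !flatten_indexKr //.
    exact: val_inj.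
  rewrite -[RHS]card_ord -(card_imset predT g_inj); apply: eq_card => i.
  rewrite inE; apply/eqP/imsetP => [bi|[c _ ->]]; last exact: flatten_indexKl.
  have offi : (off i < nth 0%N w r)%N by rewrite -bi; apply: offP.
  exists (Ordinal offi) => //; apply/val_inj => /=.
  by rewrite -[LHS](reshape_indexK w) -bi.
have porbitsE : porbits s = [set fib r | r : 'I_(size w)].
  apply/setP=> X; apply/imsetP/imsetP => [[i _ ->]|[r _ ->]].
    by exists (Ordinal (blkP i)); rewrite ?porbit_fib.
  by have [i bi] := fib_ex r (ltn_ord r); exists i; rewrite ?porbit_fib ?bi.
have fib_inj : injective (fun r : 'I_(size w) => fib r).
  move=> r r' eq_fib; have [i bi] := fib_ex r (ltn_ord r).
  have : i \in fib r' by rewrite -eq_fib inE bi.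
  by rewrite inE bi => /eqP/val_inj.
exists s; rewrite /cycle_type /image_mem.
have enum_eq : perm_eq (enum (porbits s)) [seq fib (val r) | r <- enum 'I_(size
  w)].
  apply: uniq_perm; rewrite ?enum_uniq ?(map_inj_uniq fib_inj) ?enum_uniq // =>
    X.
  rewrite mem_enum porbitsE; apply/imsetP/mapP => [[r _ ->]|[r _ ->]].
    by exists r; rewrite ?mem_enum.
  by exists r.
apply: perm_trans (perm_map _ enum_eq) _; rewrite -map_comp.
rewrite (eq_map (g := fun r : 'I_(size w) => nth 0%N w r)) => [|r /=]; last
  exact: card_fib.
by rewrite (map_comp (nth 0%N w)) val_enum_ord map_nth_iota0 // take_size.
Qed.

Section ChBasis.
Variable K : fieldType.
Hypothesis charK0 : [pchar K] =i pred0.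

Lemma part_sorted n (p : partition_of n) : sorted geq p.
Proof. exact: (valP p). Qed.

Lemma part_comp_word n (p : partition_of n) : is_comp n p.
Proof. exact: (valP (val p)). Qed.

Lemma part_inj n (p q : partition_of n) : perm_eq p q -> p = q.
Proof.
move=> pq; apply/val_inj/comp_word_inj.
by apply: sorted_geq_perm; rewrite ?part_sorted.
Qed.

Lemma exists_part n w : is_comp n w -> exists p : partition_of n, perm_eq p w.
Proof.
move=> cw; have pw : perm_eq (sort geq w) w by rewrite perm_sort.
have /comp_wordP[q eq_q] : is_comp n (sort geq w) by rewrite (is_comp_perm _
  pw).
have sq : sorted geq q by rewrite -eq_q; apply/sort_sorted/geq_total.
by exists (exist _ q sq); rewrite /= -eq_q.
Qed.

Lemma qfactK_neq0 n w : is_comp n w -> (qfact w)%:R != 0 :> K.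
Proof. by case/andP=> _ w0; rewrite natK_neq0 ?qfact_gt0. Qed.

Lemma ch_free n (a : partition_of n -> K) :
  \sum_(p : partition_of n) a p *: ch K n p = 0 -> forall p, a p = 0.
Proof.
move=> sum0 p; have [s sp] := exists_cycle_type (part_comp_word p).
have /ffunP/(_ s) := sum0; rewrite sum_ffunE ffunE (bigD1 p) //= big1 ?addr0.
  rewrite !ffunE sp [_%:R *: _]mulr1 => /eqP; rewrite mulf_eq0.
  by rewrite (negbTE (qfactK_neq0 (part_comp_word p))) orbF => /eqP.
move=> q qp; rewrite !ffunE; case: (boolP (perm_eq _ _)) => [sq|]; last by
  rewrite [_ *: 0]mulr0 [LHS]mulr0.
case/eqP: qp; apply: part_inj; rewrite perm_sym.
by apply: perm_trans sq; rewrite perm_sym.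
Qed.

Lemma ch_perm n v w : perm_eq v w -> ch K n v = ch K n w.
Proof.
move=> vw; rewrite /ch (qfact_perm vw); congr (_ *: _).
by apply/ffunP=> s; rewrite !ffunE (permPr vw).
Qed.

End ChBasis.

(** The witness is the hook with parts n - k + 1, 1, ..., 1; its first part is odd as n - k is
    even. *)
Lemma exists_odd_part n k : (0 < k <= n)%N -> odd k = odd n ->
  exists p : partition_of n, all odd p && (size p == k).
Proof.
move=> kn odd_k; pose w := (n - k).+1 :: nseq k.-1 1%N.
have cw : is_comp n w.
  rewrite /is_comp /= sumn_nseq mul1n inE negb_or /= mem_nseq andbF andbT.
  by apply/eqP; lia.
have [p pw] := exists_part cw; exists p.
rewrite (perm_all _ pw) (perm_size pw) /= size_nseq all_nseq orbT andbT.
have /andP[k0 le_kn] := kn.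
by rewrite prednK // eqxx andbT oddB // odd_k addbb.
Qed.

Section Nonzero.
Variable K : fieldType.
Hypothesis charK0 : [pchar K] =i pred0.

(** As K carries no order, the sum is rewritten as a quotient of two positive integers, which is
    nonzero in characteristic 0. *)
Lemma sum_natV_neq0 (I : finType) (P : pred I) (q : I -> nat) i0 :
  P i0 -> (forall i, 0 < q i)%N -> \sum_(i | P i) (q i)%:R^-1 != 0 :> K.
Proof.
move=> Pi0 q0; have frac (S : pred I) : exists m d,
    (0 < d)%N /\ \sum_(i | S i) (q i)%:R^-1 = m%:R / d%:R :> K.
  apply: (big_ind (fun x => exists m d, (0 < d)%N /\ x = m%:R / d%:R)).
  - by exists 0%N, 1%N; rewrite mul0r.
  - move=> _ _ [m [d [d0 ->]]] [m' [d' [d'0 ->]]].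
    exists (m * d' + m' * d)%N, (d * d')%N; rewrite muln_gt0 d0; split=> //.
    by rewrite natrD !natrM addf_div ?natK_neq0.
  by move=> i _; exists 1%N, (q i); rewrite mul1r.
rewrite (bigD1 i0) //=; have [m [d [d0 ->]]] := frac (fun i => P i && (i !=
  i0)).
rewrite -[_^-1]mul1r addf_div ?natK_neq0 // mulf_neq0 ?invr_eq0 // -!natrM.
  by rewrite mul1r -natrD natK_neq0 // addn_gt0 d0.
by rewrite natK_neq0 // muln_gt0 q0.
Qed.

(** The identity has no descents, so its coefficient in every Xi q is 1. This is the case y_i = h_i
    = 1 of [L_eidem], where exp (sum_i t^i / i) = 1 / (1 - t), and the coefficient becomes a
    nonempty sum of terms 1 / p?. *)
Lemma eidem_neq0 n k : (0 < k <= n)%N -> odd k = odd n -> eidem K n k != 0.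
Proof.
move=> kn odd_k; have n_gt0 : (0 < n)%N by lia.
have [|L LE] := @exists_linear _ (KS K n) {poly K} (fun x => (x 1%g)%:P).
  by move=> a x y; rewrite ffunE galg_scaleE polyCD polyCM mul_polyC.
have one_exp : is_exp (fun=> 1 : {poly K}) (fun=> 1).
  by split=> // m; under eq_bigr => i _ do rewrite mul1r; rewrite sumr_const
    card_ord scaler_nat.
have L_Xi q : is_comp n q -> L (Xi K n q) = \prod_(i <- q) 1.
  move=> _; rewrite LE XiE big1_eq; suff -> : Des (1%g : {perm 'I_n}) = set0 by
    rewrite sub0set.
  apply/setP=> i; rewrite in_Des inE; apply/negP => /andP[i0].
  have lt_in : (i.-1 < n)%N by have := ltn_ord i; lia.
  by rewrite nth_word -[i.-1]/(val (Ordinal lt_in)) nth_word !perm1 /=; lia.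
have /andP[k0 le_kn] := kn.
apply/eqP => e0; have := L_eidem charK0 n_gt0 one_exp L_Xi le_kn.
rewrite e0 linear0 => /(congr1 (fun p : {poly K} => p`_0)) /eqP.
rewrite coef0 coef_sum eq_sym; apply/negP.
under eq_bigr => p _ do rewrite big1_eq coefZ coef1 mulr1.
have [p Pp] := exists_odd_part kn odd_k.
apply: (@sum_natV_neq0 _ _ (fun p : partition_of n => qfact p) p Pp) => q.
by apply: qfact_gt0; case/andP: (part_comp_word q).
Qed.

End Nonzero.

(** * The Frobenius characteristic and the values of c *)

Section Weights.
Variable N : nat.

Lemma digits_inj M (a b : nat -> nat) :
    (forall i, a i < N)%N -> (forall i, b i < N)%N ->
    (\sum_(i < M) a i * N ^ i = \sum_(i < M) b i * N ^ i)%N ->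
  forall i, (i < M)%N -> a i = b i.
Proof.
elim: M a b => // M IHM a b ltaN ltbN; rewrite !big_ord_recl /= !muln1.
have shift (c : nat -> nat) : (\sum_(i < M) c (bump 0 i) * N ^ bump 0 i =
    (\sum_(i < M) c i.+1 * N ^ i) * N)%N.
  by rewrite big_distrl; apply: eq_bigr => i _; rewrite /bump add1n expnSr
    mulnA.
rewrite !shift => eq_ab.
have eq0 : a 0%N = b 0%N.
  have /(congr1 (modn^~ N)) := eq_ab.
  by rewrite !(addnC _ (_ * N)%N) !modnMDl !modn_small.
case=> [|i] // lti; apply: (IHM (a \o succn) (b \o succn)) => //=.
move/eqP: eq_ab; rewrite eq0 eqn_add2l eqn_pmul2r => [/eqP//|].
exact: leq_ltn_trans (ltaN 0%N).
Qed.

(** An integer whose digits in base N are the multiplicities of the entries, provided these are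
    smaller than N. *)
Definition weight (w : seq nat) : nat := (\sum_(i <- w) N ^ i)%N.

Lemma weight_count M w : all (fun i => i < M)%N w ->
  weight w = (\sum_(i < M) count_mem (val i) w * N ^ i)%N.
Proof.
elim: w => [|j w IHw] /=; first by rewrite /weight big_nil big1.
move=> /andP[ltjM /IHw]; rewrite /weight big_cons => ->.
under [RHS]eq_bigr => i _ do rewrite mulnDl.
rewrite big_split /=; congr (_ + _)%N.
rewrite (bigD1 (Ordinal ltjM)) //= eqxx mul1n big1 ?addn0 // => i.
by rewrite -val_eqE /= eq_sym => /negbTE->.
Qed.

Lemma weight_inj M v w : all (fun i => i < M)%N v -> all (fun i => i < M)%N w ->
  (size v < N)%N -> (size w < N)%N -> weight v = weight w -> perm_eq v w.
Proof.
move=> ltv ltw szv szw; rewrite !(weight_count (M := M)) // => eq_vw.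
have cnt i : (i < M)%N -> count_mem i v = count_mem i w.
  apply: (@digits_inj _ (fun i => count_mem i v) (fun i => count_mem i w)) =>
    // j.
    exact: leq_ltn_trans (count_size _ _) szv.
  exact: leq_ltn_trans (count_size _ _) szw.
apply/allP=> i; rewrite mem_cat => /orP[/(allP ltv)|/(allP ltw)] lti /=; by
  rewrite cnt.
Qed.

End Weights.

Lemma Xi_Dspace (K : fieldType) n q : Xi K n q \in Dspace K n.
Proof. by apply: memv_suml => E _; apply/memv_span/map_f; rewrite mem_enum. Qed.

Lemma star_Xi (K : fieldType) m n r q : is_comp m r -> is_comp n q ->
  star (Xi K m r) (Xi K n q) = Xi K (m + n) (r ++ q).
Proof.
move=> cr cq; have single k t : is_comp k t ->
    Xi K k t = \sum_(t' : composition k) (comp_word t' == t)%:R *: Xi K k t'.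
  move=> /comp_wordP[t0 ->]; rewrite (bigD1 t0) //= eqxx scale1r big1 ?addr0 //
    => t'.
  by rewrite (inj_eq (@comp_word_inj k)) => /negbTE->; rewrite scale0r.
rewrite (single m r) // (single n q) // (star_sum _ _ (fun t => (t == r)%:R)
  (fun t => (t == q)%:R)).
have [r0 def_r] := comp_wordP cr; have [q0 def_q] := comp_wordP cq.
rewrite (bigD1 r0) //= (bigD1 q0) //= -def_r -def_q !eqxx mulr1 scale1r.
rewrite big1 ?addr0 => [|q1]; last first.
  by rewrite -(inj_eq (@comp_word_inj n)) -def_q => /negbTE->; rewrite mulr0
    scale0r.
rewrite big1 ?addr0 // => r1; rewrite -(inj_eq (@comp_word_inj m)) -def_r =>
  /negbTE->.
by rewrite big1 // => q1 _; rewrite mul0r scale0r.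
Qed.

Section Characteristic.
Variables (K : fieldType) (N : nat).
Hypothesis charK0 : [pchar K] =i pred0.

Definition chc m (p : partition_of m) (f : CF K m) : K :=
  fcoord (fun p : partition_of m => ch K m p) p f.

Lemma chc_lin m p a (f g : CF K m) : chc p (a *: f + g) = a * chc p f + chc p g.
Proof. exact: linearP. Qed.

Lemma chc_sum m (a : partition_of m -> K) p :
  chc p (\sum_(q : partition_of m) a q *: ch K m q) = a p.
Proof. by rewrite /chc fcoord_sum //; apply: ch_free. Qed.

(* The classes ch_p are sent to monomials whose degrees separate the           *)
(* partitions of any integer less than N.                                      *)
Definition frob m (f : CF K m) : {poly K} :=
  \sum_(p : partition_of m) chc p f *: 'X^(weight N p).

(** [chc] gives true coordinates only on the span of the elements [ch p]. The equation [proj f = f]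
    places [f] in that span, where [frob f] determines it. *)
Definition proj m (f : CF K m) : CF K m :=
  \sum_(p : partition_of m) chc p f *: ch K m p.

Lemma frob_lin m a (f g : CF K m) : frob (a *: f + g) = a *: frob f + frob g.
Proof.
rewrite /frob scaler_sumr -big_split; apply: eq_bigr => p _ /=.
by rewrite chc_lin scalerDl scalerA.
Qed.

Lemma proj_lin m a (f g : CF K m) : proj (a *: f + g) = a *: proj f + proj g.
Proof.
rewrite /proj scaler_sumr -big_split; apply: eq_bigr => p _ /=.
by rewrite chc_lin scalerDl scalerA.
Qed.

Lemma proj_sum m (a : partition_of m -> K) :
  proj (\sum_(q : partition_of m) a q *: ch K m q) = \sum_(q : partition_of m)
    a q *: ch K m q.
Proof. by apply: eq_bigr => p _; rewrite chc_sum. Qed.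

Lemma frob_sum m (a : partition_of m -> K) :
  frob (\sum_(q : partition_of m) a q *: ch K m q) = \sum_(q : partition_of m)
    a q *: 'X^(weight N q).
Proof. by apply: eq_bigr => p _; rewrite chc_sum. Qed.

Lemma ch_single m w : is_comp m w -> exists2 p : partition_of m, perm_eq p w &
  ch K m w = \sum_(q : partition_of m) (q == p)%:R *: ch K m q.
Proof.
move=> /exists_part[p pw]; exists p => //.
rewrite -(ch_perm _ _ pw) (bigD1 p) //= eqxx scale1r big1 ?addr0 // => q
  /negbTE->.
by rewrite scale0r.
Qed.

Lemma proj_ch m w : is_comp m w -> proj (ch K m w) = ch K m w.
Proof. by case/ch_single=> p _ ->; rewrite proj_sum. Qed.

Lemma frob_ch m w : is_comp m w -> frob (ch K m w) = 'X^(weight N w).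
Proof.
case/ch_single=> p pw ->; rewrite frob_sum (bigD1 p) //= eqxx scale1r big1
  ?addr0.
  by rewrite /weight (perm_big _ pw).
by move=> q /negbTE->; rewrite scale0r.
Qed.

Lemma weight_cat v w : weight N (v ++ w) = (weight N v + weight N w)%N.
Proof. exact: big_cat. Qed.

Lemma lin_comb_sum (V W : lmodType K) (F : V -> W) (I : finType) (a : I -> K)
  (v : I -> V) :
  (forall b x y, F (b *: x + y) = b *: F x + F y) ->
  F (\sum_i a i *: v i) = \sum_i a i *: F (v i).
Proof.
move=> linF; have [FL FLE] := @exists_linear _ V W F linF.
by rewrite -FLE linear_sum; apply: eq_bigr => i _; rewrite linearZ FLE.
Qed.

Lemma is_comp_cat_parts m n (p : partition_of m) (q : partition_of n) : is_comp
  (m + n) (p ++ q).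
Proof.
have cp := part_comp_word p.
by rewrite is_comp_cat ?cp ?part_comp_word //; case/andP: cp => /eqP.
Qed.

Lemma outerE m n (f : CF K m) (g : CF K n) : outer f g =
  \sum_(p : partition_of m) chc p f *: \sum_(q : partition_of n) chc q g *: ch
    K (m + n) (p ++ q).
Proof.
apply: eq_bigr => p _; rewrite scaler_sumr; apply: eq_bigr => q _; by rewrite
  scalerA.
Qed.

Lemma frob_outer m n (f : CF K m) (g : CF K n) : frob (outer f g) = frob f *
  frob g.
Proof.
rewrite outerE lin_comb_sum; last exact: frob_lin.
rewrite mulr_suml; apply: eq_bigr => p _; rewrite -scalerAl; congr (_ *: _).
rewrite lin_comb_sum; last exact: frob_lin.
rewrite mulr_sumr; apply: eq_bigr => q _; rewrite -scalerAr; congr (_ *: _).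
by rewrite frob_ch ?is_comp_cat_parts // weight_cat exprD.
Qed.

Lemma proj_outer m n (f : CF K m) (g : CF K n) : proj (outer f g) = outer f g.
Proof.
rewrite outerE lin_comb_sum; last exact: proj_lin.
apply: eq_bigr => p _; congr (_ *: _); rewrite lin_comb_sum; last exact:
  proj_lin.
by apply: eq_bigr => q _; rewrite proj_ch ?is_comp_cat_parts.
Qed.

Lemma char_word_ch m (p : partition_of m) : char_word K m p = (qfact p)%:R^-1
  *: ch K m p.
Proof. by rewrite /ch scalerA mulVf ?scale1r // (qfactK_neq0 charK0
  (part_comp_word p)). Qed.

Lemma one_ch m : [ffun=> 1] = \sum_(p : partition_of m) (qfact p)%:R^-1 *: ch K
  m p.
Proof.
apply/ffunP=> s; rewrite ffunE sum_ffunE.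
under eq_bigr => p _ do rewrite -char_word_ch ffunE.
have [p ps] := exists_part (is_comp_cycle_type s).
rewrite (bigD1 p) //= perm_sym ps big1 ?addr0 // => q qp.
case: (boolP (perm_eq _ _)) => // sq; case/eqP: qp; apply: part_inj.
by rewrite perm_sym; apply: perm_trans ps sq.
Qed.

Definition powersum i : {poly K} := 'X^(N ^ i).

Lemma prod_powersum w : \prod_(i <- w) powersum i = 'X^(weight N w).
Proof.
elim: w => [|i w IHw]; first by rewrite /weight !big_nil.
by rewrite /weight !big_cons exprD IHw.
Qed.

Lemma frob_one m : frob ([ffun=> 1] : CF K m) = psum_exp powersum m.
Proof.
by rewrite one_ch frob_sum; apply: eq_bigr => p _; rewrite prod_powersum.
Qed.

Variable c : forall m, 'Hom(KS K m, CF K m).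
Hypothesis c_hom : solomon_hom c.

(** By the homomorphism property, c maps Xi q to an outer product of trivial characters, whose
    Frobenius characteristics are complete symmetric functions. *)
Lemma c_Xi m q : is_comp m q ->
  frob (c m (Xi K m q)) = \prod_(i <- q) psum_exp powersum i /\
  proj (c m (Xi K m q)) = c m (Xi K m q).
Proof.
have [_ c_star c_one] := c_hom.
have one k : frob (c k (Xi K k [:: k])) = psum_exp powersum k /\
    proj (c k (Xi K k [:: k])) = c k (Xi K k [:: k]).
  by rewrite c_one frob_one one_ch proj_sum.
elim: q m => [|a q IHq] m cq.
  have m0 : m = 0%N by case/andP: cq => /= /eqP.
  (* In degree 0 the normalization of [c] concerns the word with the single letter 0, which gives
     the same element as the empty word. *)
  subst m; have -> : Xi K 0 [::] = Xi K 0 [:: 0%N].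
    by apply/ffunP=> s; rewrite !XiE; congr (nat_of_bool _)%:R;
      apply/subsetP/subsetP => _ [].
  have [-> ->] := one 0%N; rewrite big_nil.
  by have [-> _] := psum_exp_is_exp charK0 powersum.
have /andP[/eqP m_sum aq0] := cq; move: cq; rewrite /= in m_sum; subst m => cq.
have ca : is_comp a [:: a].
  by rewrite /is_comp /= addn0 eqxx; move: aq0; rewrite !inE !negb_or =>
    /andP[->].
have cq' : is_comp (sumn q) q.
  by rewrite /is_comp eqxx; move: aq0; rewrite inE negb_or => /andP[].
rewrite -[a :: q]/([:: a] ++ q) -star_Xi // c_star ?Xi_Dspace //.
have [frob_a _] := one a; have [frob_q _] := IHq _ cq'.
by rewrite proj_outer frob_outer frob_a frob_q big_cat big_seq1.
Qed.

(** [L_eidem] for [frob] after [c] gives the coordinates of the image, because distinct partitions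
    of n have distinct weights. *)
Lemma c_eidem n k : (0 < n < N)%N -> (k <= n)%N -> c n (eidem K n k) = char_num
  K n k.
Proof.
move=> /andP[n_gt0 lt_nN] le_kn; set e := eidem K n k.
have h_exp := psum_exp_is_exp charK0 powersum.
have frob_e : frob (c n e) = \sum_(p : partition_of n | all odd p && (size p ==
  k))
    (qfact p)%:R^-1 *: 'X^(weight N p).
  have [|L LE] := @exists_linear _ (KS K n) {poly K} (fun x => frob (c n x)).
    by move=> a x y; rewrite linearP frob_lin.
  rewrite -LE (L_eidem charK0 n_gt0 h_exp _ le_kn) => [|q cq]; last by rewrite
    LE; case: (c_Xi cq).
  by apply: eq_bigr => p _; rewrite prod_powersum.
have proj_e : proj (c n e) = c n e.
  apply/ffunP=> s; apply/esym/eqP; rewrite -subr_eq0; apply/eqP/polyC_inj.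
  (* The linear map x -> frob (c x) + (c x - proj (c x))(s) agrees with frob (c x) on every Xi q.
     Since [L_eidem] depends only on these values, both maps agree on [e], and the additional term
     vanishes there. *)
  apply: (addrI (frob (c n e))); rewrite addr0.
  have [|L LE] := @exists_linear _ (KS K n) {poly K}
      (fun x => frob (c n x) + ((c n x) s - proj (c n x) s)%:P).
    move=> a x y; rewrite linearP frob_lin proj_lin !ffunE -!mul_polyC.
    rewrite !(polyCB, polyCD, polyCM); ring.
  rewrite -LE (L_eidem charK0 n_gt0 h_exp _ le_kn) => [|q cq]; last first.
    by rewrite LE; have [-> ->] := c_Xi cq; rewrite subrr addr0.
  by rewrite frob_e; apply: eq_bigr => p _; rewrite prod_powersum.
have inj_weight (p q : partition_of n) : weight N p = weight N q -> p = q.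
  move=> eq_w; apply: part_inj; apply: (weight_inj (M := n.+1)) eq_w.
  - by apply/allP=> _ /mapP[i _ ->]; apply: ltn_ord.
  - by apply/allP=> _ /mapP[i _ ->]; apply: ltn_ord.
  - by rewrite size_map; apply: leq_ltn_trans lt_nN; apply: size_bseq.
  by rewrite size_map; apply: leq_ltn_trans lt_nN; apply: size_bseq.
have coef (S : pred (partition_of n)) (a : partition_of n -> K) (p :
  partition_of n) :
    (\sum_(q : partition_of n | S q) a q *: 'X^(weight N q))`_(weight N p) = if
      S p then a p else 0.
  rewrite coef_sum big_mkcond (bigD1 p) //= coefZ coefXn eqxx mulr1 big1 ?addr0
    // => q qp.
  rewrite coefZ coefXn; case: eqP => [/inj_weight pq|_]; last by rewrite mulr0
    if_same.
  by rewrite pq eqxx in qp.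
rewrite -proj_e /char_num [RHS]big_mkcond; apply: eq_bigr => p _.
have := congr1 (fun P : {poly K} => P`_(weight N (p : partition_of n))) frob_e.
rewrite /frob !coef => ->; case: ifP => _; last by rewrite scale0r.
by rewrite char_word_ch.
Qed.

End Characteristic.

(** * The span of the peak number sums *)

Lemma mem_span_map (K : fieldType) (V : vectType K) (f : nat -> V) s v : uniq s
  ->
  v \in <<[seq f k | k <- s]>>%VS -> exists a : nat -> K, v = \sum_(k <- s) a k
    *: f k.
Proof.
elim: s v => [|k s IHs] v /=.
  by rewrite span_nil memv0 => _ /eqP->; exists (fun=> 0); rewrite big_nil.
case/andP=> ks us; rewrite span_cons => /memv_addP[_ /vlineP[b ->] [w /(IHs _
  us)[a ->] ->]].
exists (fun j => if j == k then b else a j); rewrite big_cons eqxx; congr (_ +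
  _).
by apply: eq_big_seq => j js; case: eqP => // jk; rewrite -jk js in ks.
Qed.

Lemma count_odd_iota b n :
  count (fun k => odd k == b) (iota 1 n) = if b then uphalf n else n./2.
Proof.
elim: n => [|n IHn]; first by case: b.
have -> : iota 1 n.+1 = iota 1 n ++ [:: n.+1] by rewrite -[in LHS](addn1 n)
  iotaD.
rewrite count_cat IHn /= addn0 uphalf_half.
by case: b {IHn}; case: (odd n); rewrite /= ?addn0 ?addn1 ?add0n ?add1n.
Qed.

Section Main.
Variables (K : fieldType) (n : nat).
Hypothesis charK0 : [pchar K] =i pred0.
Hypothesis n_gt0 : (0 < n)%N.

Local Notation e := (eidem K n).
Local Notation E := (Etilde K n).

Definition parity_range := [seq k <- iota 1 n | odd k == odd n].
Local Notation ks := parity_range.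

Lemma mem_parity k : (k \in ks) = (0 < k <= n)%N && (odd k == odd n).
Proof. by rewrite mem_filter mem_iota add1n ltnS andbC. Qed.

Lemma parity_uniq : uniq ks.
Proof. exact/filter_uniq/iota_uniq. Qed.

Lemma size_parity : size ks = uphalf n.
Proof. by rewrite size_filter count_odd_iota uphalf_half; case: (odd n). Qed.

Definition comb (a : nat -> K) : KS K n := \sum_(k <- ks) a k *: e k.

Lemma comb_mul_e a k : k \in ks -> comb a * e k = a k *: e k.
Proof.
move=> kks; rewrite mulr_suml (bigD1_seq k) ?parity_uniq //=.
have le_n j : j \in ks -> (j <= n)%N by rewrite mem_parity => /andP[/andP[]].
rewrite -scalerAl (eidem_mul charK0 n_gt0) ?le_n // eqxx scale1r big_seq_cond
  big1 ?addr0 // => j.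
by case/andP=> jks /negbTE jk; rewrite -scalerAl (eidem_mul charK0 n_gt0) ?le_n
  // jk scale0r scaler0.
Qed.

Lemma comb_mul a b : comb a * comb b = comb (fun k => a k * b k).
Proof.
rewrite {2}/comb mulr_sumr; apply: eq_big_seq => k kks.
by rewrite -scalerAr comb_mul_e // scalerA mulrC.
Qed.

Lemma comb_inj a b : comb a = comb b -> {in ks, a =1 b}.
Proof.
move=> eq_ab k kks; have := comb_mul_e a kks; rewrite eq_ab comb_mul_e // =>
  /eqP.
rewrite -subr_eq0 -scalerBl scaler_eq0 subr_eq0.
move: kks; rewrite mem_parity => /andP[kn /eqP odd_k].
by rewrite (negbTE (eidem_neq0 charK0 kn odd_k)) orbF => /eqP.
Qed.

Lemma eidem_in_Etilde k : k \in ks -> e k \in E.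
Proof.
by rewrite mem_parity => /andP[/andP[_ le_kn] _];
  apply/memvZ/rho_tilde_in_Etilde.
Qed.

Lemma eidem_free : free [seq e k | k <- ks].
Proof.
pose X := map_tuple e (in_tuple ks).
suff : free X by [].
apply/freeP => a sum0 i; pose a' k := if insub (index k ks) is Some j then a j
  else 0.
have nthi (j : 'I_(size ks)) : a' (nth 0%N ks j) = a j.
  by rewrite /a' index_uniq ?parity_uniq // insubT ?ltn_ord // => lt; congr a;
    apply/val_inj.
have : comb a' = comb (fun=> 0).
  rewrite /comb [RHS]big1 => [|k _]; last by rewrite scale0r.
  rewrite -[RHS]sum0 (big_nth 0%N) big_mkord; apply: eq_bigr => j _.
  by rewrite nthi (nth_map 0%N).
by move/comb_inj/(_ (nth 0%N ks i)); rewrite nthi => -> //; apply: mem_nth.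
Qed.

(** These are [uphalf n] independent elements of a space of dimension at most [uphalf n]. *)
Lemma eidem_basis : basis_of E [seq e k | k <- ks].
Proof.
rewrite basisEfree eidem_free size_map size_parity dim_Etilde_le // andbT /=.
by apply/span_subvP => _ /mapP[k kks ->]; apply: eidem_in_Etilde.
Qed.

Lemma dim_Etilde : \dim E = uphalf n.
Proof. by rewrite -(span_basis eidem_basis) (eqP eidem_free) size_map
  size_parity. Qed.

Lemma Etilde_comb x : x \in E -> exists a, x = comb a.
Proof. by rewrite -(span_basis eidem_basis) => /(mem_span_map parity_uniq). Qed.

Lemma comb_in_Etilde a : comb a \in E.
Proof.
by rewrite /comb big_seq memv_suml // => k kks; apply/memvZ/eidem_in_Etilde.
Qed.

Lemma Etilde_mul : (E * E <= E)%VS.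
Proof.
apply/prodvP => x y /Etilde_comb[a ->] /Etilde_comb[b ->].
by rewrite comb_mul comb_in_Etilde.
Qed.

Lemma Etilde_comm : {in E &, forall x y, x * y = y * x}.
Proof.
move=> x y /Etilde_comb[a ->] /Etilde_comb[b ->]; rewrite !comb_mul.
by apply: eq_bigr => k _; rewrite mulrC.
Qed.

Lemma Pi_num0_in_Etilde : Pi_num K n 0 \in E.
Proof. exact/memv_span/map_f. Qed.

Lemma Pi_num0_comb : Pi_num K n 0 = comb (fun k => 2 ^+ k.-1).
Proof.
have [a def_a] := Etilde_comb Pi_num0_in_Etilde; rewrite def_a.
apply: eq_big_seq => k kks; have := comb_mul_e a kks; rewrite -def_a => <-.
by apply: Pi_num0_eidem => //; move: kks; rewrite mem_parity => /andP[].
Qed.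

Lemma pow2_inj i j : 2%:R ^+ i = 2%:R ^+ j :> K -> i = j.
Proof.
wlog lt_ij : i j / (i < j)%N => [wl|].
  by case: (ltngtP i j) => // [|lt_ji] eq_ij; [apply: wl | apply/esym/wl].
move/eqP; rewrite eq_sym -!natrX -subr_eq0 -natrB ?leq_exp2l ?(ltnW lt_ij) //.
by rewrite (negbTE (natK_neq0 charK0 _)) // subn_gt0 ltn_exp2l.
Qed.

(* Any subalgebra containing Pi_num 0 contains the values at Pi_num 0 of the   *)
(* polynomials without constant term, hence the idempotents by Lagrange        *)
(* interpolation at its distinct nonzero eigenvalues 2 ^ (k - 1).              *)
Lemma Etilde_generated : generated_by E (Pi_num K n 0).
Proof.
split; [exact: Etilde_mul | exact: Pi_num0_in_Etilde | move=> F FF yF].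
(* With Y = [Pi_num K n 0], this is the eigenvalue on [e j] of Y times the product of the factors Y
   - 2^(l-1) for l in [s]. The leading factor Y keeps the element in [F], which need not contain an
   identity. *)
pose lagrange s j : K := 2 ^+ j.-1 * \prod_(l <- s) (2 ^+ j.-1 - 2 ^+ l.-1).
have step s : comb (lagrange s) \in F.
  elim: s => [|l s IHs].
    have <- // : Pi_num K n 0 = comb (lagrange [::]).
    by rewrite Pi_num0_comb; apply: eq_bigr => j _; rewrite /lagrange big_nil
      mulr1.
  have -> : comb (lagrange (l :: s)) =
      comb (lagrange s) * Pi_num K n 0 - 2 ^+ l.-1 *: comb (lagrange s).
    rewrite Pi_num0_comb comb_mul /comb scaler_sumr -sumrB; apply: eq_bigr => j
      _.
    by rewrite /= [X in _ - X]scalerA -scalerBl /lagrange big_cons; congr (_ *: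
      _); ring.
  by rewrite memvB ?memvZ //; apply: (subvP FF); apply: memv_mul.
rewrite -(span_basis eidem_basis); apply/span_subvP => _ /mapP[k kks ->].
(* Taking all indices except k annihilates every idempotent but [e k]. *)
have := step (rem k ks); rewrite /comb (bigD1_seq k) ?parity_uniq //=.
rewrite big_seq_cond big1 ?addr0 => [|j /andP[jks jk]]; last first.
  rewrite /lagrange (big_rem j) /= ?subrr ?mul0r ?mulr0 ?scale0r //.
  by rewrite mem_rem_uniq ?parity_uniq // inE jk.
move/(memvZ (lagrange (rem k ks) k)^-1).
rewrite scalerA mulVf ?scale1r // mulf_neq0 ?pow2_neq0 // prodf_seq_neq0.
apply/allP=> l; rewrite mem_rem_uniq ?parity_uniq // inE => /andP[lk lks] /=.
rewrite subr_eq0; apply: contra lk => /eqP/pow2_inj.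
by move: lks kks; rewrite !mem_parity => /andP[/andP[l0 _] _] /andP[/andP[k0 _]
  _]; lia.
Qed.

Lemma char_numE k s : char_num K n k s =
  (all odd (cycle_type s) && (size (cycle_type s) == k))%:R.
Proof.
rewrite sum_ffunE; under eq_bigr => p _ do rewrite ffunE.
have [p ps] := exists_part (is_comp_cycle_type s).
rewrite big_mkcond (bigD1 p) //= perm_sym ps big1 ?addr0.
  by rewrite (perm_all _ ps) (perm_size ps); case: ifP.
move=> q qp; case: ifP => // _; case: (boolP (perm_eq _ _)) => // sq.
by case/eqP: qp; apply: part_inj; rewrite perm_sym; apply: perm_trans ps sq.
Qed.

Lemma char_num0 : char_num K n 0 = 0.
Proof.
apply/ffunP=> s; rewrite char_numE ffunE; case: eqP => [/size0nil s0|]; last by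
  rewrite andbF.
by have := card_porbits_sum s; rewrite s0 /= => n0; move: n_gt0; rewrite -n0.
Qed.

(** * The restriction of c *)

Section Restriction.
Variable c : forall m, 'Hom(KS K m, CF K m).
Hypothesis c_hom : solomon_hom c.

Lemma c_comb a : c n (comb a) = \sum_(k <- ks) a k *: char_num K n k.
Proof.
rewrite linear_sum; apply: eq_big_seq => k; rewrite mem_parity => /andP[/andP[_
  le_kn] _].
by rewrite linearZ /= (c_eidem (N := n.+1) charK0 c_hom) // n_gt0 ltnSn.
Qed.

Lemma c_combE a s : c n (comb a) s =
  \sum_(k <- ks) a k * (all odd (cycle_type s) && (size (cycle_type s) ==
    k))%:R.
Proof.
by rewrite c_comb sum_ffunE; apply: eq_bigr => k _; rewrite ffunE char_numE.
Qed.

Lemma sum_delta (a : nat -> K) b j :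
  \sum_(k <- ks) a k * (b && (j == k))%:R = (b && (j \in ks))%:R * a j.
Proof.
case: b; last by rewrite big1 ?mul0r // => k _; rewrite mulr0.
have [jks|jks] := boolP (j \in ks); last first.
  rewrite mul0r big1_seq // => k /andP[_ kks]; case: eqP => [jk|_]; last by
    rewrite mulr0.
  by rewrite jk kks in jks.
rewrite (bigD1_seq j) ?parity_uniq //= eqxx mulr1 mul1r big1 ?addr0 // => k.
by rewrite eq_sym => /negbTE->; rewrite mulr0.
Qed.

(** At a permutation with j cycles, all of odd length, the image of [comb a] takes the value [a j]
    when j is in the range; elsewhere it is 0. Multiplying coefficients thus amounts to multiplying
    values pointwise. *)
Lemma c_mul : {in E &, forall x y, c n (x * y) = c n x * c n y}.
Proof.
move=> x y /Etilde_comb[a ->] /Etilde_comb[b ->]; rewrite comb_mul.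
apply/ffunP=> s; rewrite ffunE !c_combE !sum_delta.
by case: (_ && _); rewrite ?mul1r ?mul0r.
Qed.

(** The coefficient [a k] is recovered as the value at a permutation with k cycles, all of odd
    length, which exists for k = n modulo 2. *)
Lemma c_inj : {in E &, injective (c n)}.
Proof.
move=> x y /Etilde_comb[a ->] /Etilde_comb[b ->] eq_c.
apply: eq_big_seq => k kks; congr (_ *: _).
have /andP[kn /eqP odd_k] : (0 < k <= n)%N && (odd k == odd n) by rewrite
  -mem_parity.
have [p /andP[odd_p /eqP size_p]] := exists_odd_part kn odd_k.
have [s sp] := exists_cycle_type (part_comp_word p).
have := congr1 (fun f : CF K n => f s) eq_c; rewrite /= !c_combE !sum_delta.
by rewrite (perm_all _ sp) (perm_size sp) odd_p size_p kks !mul1r.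
Qed.

Lemma c_image : (c n @: E)%VS =
  <<[seq char_num K n k | k <- iota 0 n.+1 & odd k == odd n]>>%VS.
Proof.
rewrite -(span_basis eidem_basis) limg_span -map_comp.
have -> : [seq (c n \o e) k | k <- ks] = [seq char_num K n k | k <- ks].
  apply/eq_in_map => k; rewrite mem_parity => /andP[/andP[_ le_kn] _] /=.
  by rewrite (c_eidem (N := n.+1) charK0 c_hom) // n_gt0 ltnSn.
(* The index 0, present for even n, contributes the zero function: a partition of n > 0 has at least
   one part. *)
rewrite [iota 0 _]/= [filter _ _]/=; case: ifP => // _.
by rewrite [map _ (_ :: _)]/= span_cons char_num0 (addv_idPr _) // -memvE mem0v.
Qed.

End Restriction.
End Main.

Theorem theorem9 (K : fieldType) (charK0 : [pchar K] =i pred0)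
    (n : nat) (n_gt0 : (0 < n)%N) :
  [/\ (* commutative subalgebra of the peak algebra, and its dimension *)
      [/\ (Etilde K n <= Pspace K n)%VS,
          (Etilde K n * Etilde K n <= Etilde K n)%VS,
          {in Etilde K n &, forall x y, x * y = y * x}
        & \dim (Etilde K n) = (if odd n then n.+1 %/ 2 else n %/ 2)%N],
      (* generation by a single element *)
      [/\ Pi_num K n 0 = Pi_set K set0,
          Pi_set K set0 =
            \sum_(0 <= k < n) Delta K (comp_set n (nseq k 1%N ++ [:: n - k]%N))
        & generated_by (Etilde K n) (Pi_num K n 0)],
      (* basis of mutually orthogonal idempotents *)
      let e k := (2 ^+ k)^-1 *: rho_tilde K n k in
      let ks := [seq k <- iota 1 n | odd k == odd n] in
      [/\ basis_of (Etilde K n) [seq e k | k <- ks],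
          {in ks, forall k, e k * e k = e k}
        & {in ks &, forall k l, k != l -> e k * e l = 0}]
    & (* restriction of c *)
      forall c : (forall m, 'Hom(KS K m, CF K m)), solomon_hom c ->
      [/\ {in Etilde K n &, forall x y, c n (x * y) = c n x * c n y},
          {in Etilde K n &, injective (c n)}
        & (c n @: Etilde K n)%VS =
            <<[seq char_num K n k | k <- iota 0 n.+1 & odd k == odd n]>>%VS]].
Proof.
have le_n k : k \in parity_range n -> (k <= n)%N by rewrite mem_parity =>
  /andP[/andP[]].
split.
- split; [exact: Etilde_sub_Pspace | exact: Etilde_mul | exact: Etilde_comm |].
  by rewrite dim_Etilde // !divn2; case: ifP => // odd_n; rewrite uphalf_half
    odd_n.
- split; [exact: Pi_num0 | exact: Pi_set0 | exact: Etilde_generated].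
- split; first exact: eidem_basis.
    by move=> k /le_n kn; rewrite -/(eidem K n k) eidem_mul // eqxx scale1r.
  move=> k l /le_n kn /le_n ln /negbTE kl.
  by rewrite -/(eidem K n k) -/(eidem K n l) eidem_mul // kl scale0r.
move=> c c_hom; split; [exact: c_mul | exact: c_inj | exact: c_image].
Qed.
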